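(* There is no algorithm which, given two timed automata $\mathcal{A}$ and $\mathcal{B}$, decides whether the shuffle $L(\mathcal{A})\Join L(\mathcal{B})$ is timed regular.
   Context: $\mathcal{R}$ denotes the set of positive reals. A (finite) timed word over a finite alphabet $\Sigma$ is a sequence $t_1.a_1\ldots t_n.a_n$ with $t_i\in\mathcal{R}$, $a_i\in\Sigma$, i.e. an element of the free monoid $(\mathcal{R}\times\Sigma)^\star$. A timed automaton (Alur–Dill) has finitely many real-valued clocks, finitely many states with initial and final states, and finitely many transitions each labelled by a letter of $\Sigma$ (no $\varepsilon$-transitions), carrying a diagonal-free clock guard (Boolean combination of constraints $x\sim c$, $c$ a nonnegative integer) and a set of clocks to reset; $L(\mathcal{A})$ is the set of timed words accepted by final states. A timed language is timed regular if it equals $L(\mathcal{A})$ for some timed automaton $\mathcal{A}$. The shuffle of two elements $x,y$ of a monoid is the set of all products $x_1y_1x_2y_2\cdots x_ny_n$ with $x=x_1\cdots x_n$, $y=y_1\cdots y_n$; for sets, $R_1\Join R_2=\bigcup\{x\Join y: x\in R_1, y\in R_2\}$. *)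

(* Defs.v *)
From HB Require Import structures.
From mathcomp Require Import all_boot all_order all_algebra.
From mathcomp Require Import classical_sets reals.

Set Implicit Arguments.
Unset Strict Implicit.
Unset Printing Implicit Defensive.

Import Order.TTheory GRing.Theory Num.Theory.
Local Open Scope ring_scope.
Local Open Scope classical_set_scope.

Inductive cmp := CLt | CLe | CEq | CGe | CGt.

Inductive guard (m : nat) :=
| GTrue
| GAtom of 'I_m & cmp & nat
| GNot of guard m
| GAnd of guard m & guard m
| GOr of guard m & guard m.

Record transition (k n m : nat) := Transition {
  tr_src : 'I_n;
  tr_letter : 'I_k;
  tr_guard : guard m;
  tr_reset : seq 'I_m;
  tr_tgt : 'I_n }.

(* Timed automata over the alphabet 'I_k; the sets of initial states, of final
   states and of reset clocks are given by lists of their elements. *)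
Record timed_automaton (k : nat) := TimedAutomaton {
  ta_states : nat;
  ta_clocks : nat;
  ta_init : seq 'I_ta_states;
  ta_final : seq 'I_ta_states;
  ta_trans : seq (transition k ta_states ta_clocks) }.

Section Semantics.
Variable R : realType.

(* The word t_1.a_1 ... t_n.a_n; t_i is the delay elapsed before a_i. *)
Definition timed_word (k : nat) (w : seq (R * 'I_k)) : bool :=
  all (fun ta => 0 < ta.1) w.

Definition cmp_sem (c : cmp) (x y : R) : bool :=
  match c with
  | CLt => x < y
  | CLe => x <= y
  | CEq => x == y
  | CGe => y <= x
  | CGt => y < x
  end.

Fixpoint guard_sem (m : nat) (v : 'I_m -> R) (g : guard m) : bool :=
  match g with
  | GTrue => true
  | GAtom x o c => cmp_sem o (v x) c%:R
  | GNot g1 => ~~ guard_sem v g1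
  | GAnd g1 g2 => guard_sem v g1 && guard_sem v g2
  | GOr g1 g2 => guard_sem v g1 || guard_sem v g2
  end.

Definition elapse (m : nat) (v : 'I_m -> R) (t : R) : 'I_m -> R :=
  fun x => v x + t.

Definition reset (m : nat) (v : 'I_m -> R) (X : seq 'I_m) : 'I_m -> R :=
  fun x => if x \in X then 0 else v x.

(* [accepts_from A q v w]: some run of A over w that starts in state q with
   clock valuation v ends in a final state. *)
Fixpoint accepts_from (k : nat) (A : timed_automaton k) (q : 'I_(ta_states A))
    (v : 'I_(ta_clocks A) -> R) (w : seq (R * 'I_k)) : bool :=
  match w with
  | [::] => q \in ta_final A
  | (t, a) :: w' =>
      has (fun e => [&& tr_src e == q, tr_letter e == a,
                        guard_sem (elapse v t) (tr_guard e)
                      & accepts_from (tr_tgt e)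
                          (reset (elapse v t) (tr_reset e)) w'])
          (ta_trans A)
  end.

Definition ta_lang (k : nat) (A : timed_automaton k) : set (seq (R * 'I_k)) :=
  [set w | timed_word w /\
           has (fun q => accepts_from q (fun _ => 0) w) (ta_init A)].

Definition timed_regular (k : nat) (L : set (seq (R * 'I_k))) : Prop :=
  exists A : timed_automaton k, L = ta_lang A.

End Semantics.

Arguments ta_lang R {k} A.

(* x = x_1 ... x_n, y = y_1 ... y_n and z = x_1 y_1 ... x_n y_n. *)
Definition shuffle_word (T : Type) (x y : seq T) : set (seq T) :=
  [set z | exists xs ys : seq (seq T),
     [/\ size xs = size ys, x = flatten xs, y = flatten ys
       & z = flatten [seq p.1 ++ p.2 | p <- zip xs ys]]].

Definition shuffle (T : Type) (L1 L2 : set (seq T)) : set (seq T) :=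
  [set z | exists x y, [/\ L1 x, L2 y & shuffle_word x y z]].

Inductive move := MoveL | MoveN | MoveR.

(* Algorithms are deterministic Turing machines reading a binary word, with one
   two-way infinite tape. [tm_verdict q = None] means that q is not a
   halting state, [tm_verdict q = Some b] that the machine halts in q with
   answer b. *)
Record turing_machine := TuringMachine {
  tm_state : finType;
  tm_sym : finType;
  tm_blank : tm_sym;
  tm_input : bool -> tm_sym;
  tm_input_inj : injective tm_input;
  tm_input_blank : forall b, tm_input b != tm_blank;
  tm_start : tm_state;
  tm_verdict : tm_state -> option bool;
  tm_delta : tm_state -> tm_sym -> tm_state * tm_sym * move }.

(* The tape holds rev c_left ++ c_head :: c_right, surrounded by blanks. *)
Record tm_config (M : turing_machine) := TMConfig {
  c_state : tm_state M;
  c_left : seq (tm_sym M);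
  c_head : tm_sym M;
  c_right : seq (tm_sym M) }.

Definition tm_init (M : turing_machine) (w : seq bool) : tm_config M :=
  let u := [seq tm_input M b | b <- w] in
  TMConfig (tm_start M) [::] (head (tm_blank M) u) (behead u).

Definition tm_step (M : turing_machine) (c : tm_config M) : tm_config M :=
  let: TMConfig q l a r := c in
  if tm_verdict q is Some _ then c else
  let: (q', b, d) := tm_delta q a in
  match d with
  | MoveL => TMConfig q' (behead l) (head (tm_blank M) l) (b :: r)
  | MoveN => TMConfig q' l b r
  | MoveR => TMConfig q' (b :: l) (head (tm_blank M) r) (behead r)
  end.

Definition tm_answers (M : turing_machine) (w : seq bool) (b : bool) : Prop :=
  exists n, tm_verdict (c_state (iter n (@tm_step M) (tm_init M w))) = Some b.

(* M halts on the code of every instance, with the correct answer. *)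
Definition tm_decides (M : turing_machine) (I : Type) (code : I -> seq bool)
    (P : I -> Prop) : Prop :=
  forall i, exists b : bool, tm_answers M (code i) b /\ (b <-> P i).

Definition algorithmically_decidable (I : Type) (code : I -> seq bool)
    (P : I -> Prop) : Prop :=
  exists M : turing_machine, tm_decides M code P.

Definition code_nat (n : nat) : seq bool := rcons (nseq n true) false.

Definition code_seq (T : Type) (e : T -> seq bool) (s : seq T) : seq bool :=
  rcons (flatten [seq true :: e x | x <- s]) false.

Definition code_ord (n : nat) (i : 'I_n) : seq bool := code_nat i.

Definition code_cmp (o : cmp) : seq bool :=
  code_nat match o with
           | CLt => 0%N | CLe => 1%N | CEq => 2%N | CGe => 3%N | CGt => 4%N
           end.

Fixpoint code_guard (m : nat) (g : guard m) : seq bool :=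
  match g with
  | GTrue => code_nat 0
  | GAtom x o c => code_nat 1 ++ code_ord x ++ code_cmp o ++ code_nat c
  | GNot g1 => code_nat 2 ++ code_guard g1
  | GAnd g1 g2 => code_nat 3 ++ code_guard g1 ++ code_guard g2
  | GOr g1 g2 => code_nat 4 ++ code_guard g1 ++ code_guard g2
  end.

Definition code_trans (k n m : nat) (e : transition k n m) : seq bool :=
  code_ord (tr_src e) ++ code_ord (tr_letter e) ++ code_guard (tr_guard e) ++
  code_seq (@code_ord m) (tr_reset e) ++ code_ord (tr_tgt e).

Definition code_ta (k : nat) (A : timed_automaton k) : seq bool :=
  code_nat (ta_states A) ++ code_nat (ta_clocks A) ++
  code_seq (@code_ord _) (ta_init A) ++ code_seq (@code_ord _) (ta_final A) ++
  code_seq (@code_trans _ _ _) (ta_trans A).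

(* Two timed automata over a common finite alphabet, which is part of the
   input. *)
Record ta_pair := TAPair {
  pair_alphabet : nat;
  pair_fst : timed_automaton pair_alphabet;
  pair_snd : timed_automaton pair_alphabet }.

Definition code_pair (p : ta_pair) : seq bool :=
  code_nat (pair_alphabet p) ++ code_ta (pair_fst p) ++ code_ta (pair_snd p).

Definition prefix_code (T : Type) (e : T -> seq bool) : Prop :=
  forall x y s t, e x ++ s = e y ++ t -> x = y /\ s = t.

Lemma code_nat_prefix : prefix_code code_nat.
Proof.
elim=> [|n IHn] [|p] s t //=; first by case.
by case=> /IHn [-> ->].
Qed.

Lemma code_seq_prefix (T : Type) (e : T -> seq bool) :
  prefix_code e -> prefix_code (code_seq e).
Proof.
move=> eP; rewrite /prefix_code /code_seq.
elim=> [|x xs IH] [|y ys] s t /=; first by case.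
- by [].
- by [].
by case; rewrite !rcons_cat -!catA => /eP [-> /IH [-> ->]].
Qed.

Lemma code_ord_prefix (n : nat) : prefix_code (@code_ord n).
Proof. by move=> i j s t /code_nat_prefix [/val_inj -> ->]. Qed.

Lemma code_cmp_prefix : prefix_code code_cmp.
Proof. by move=> [] [] s t /code_nat_prefix []. Qed.

Lemma code_guard_prefix (m : nat) : prefix_code (@code_guard m).
Proof.
elim=> [|x o c|g IHg|g IHg h IHh|g IHg h IHh] [|x' o' c'|g'|g' h'|g' h'] s t;
  rewrite /= -?catA /=; try by case.
- by move=> [] /code_ord_prefix [-> /code_cmp_prefix [-> /code_nat_prefix [-> ->]]].
- by move=> [] /IHg [-> ->].
- by move=> [] /IHg [-> /IHh [-> ->]].
- by move=> [] /IHg [-> /IHh [-> ->]].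
Qed.

Lemma code_trans_prefix (k n m : nat) : prefix_code (@code_trans k n m).
Proof.
move=> [p a g X q] [p' a' g' X' q'] s t; rewrite /code_trans /= -!catA.
move=> /code_ord_prefix [-> /code_ord_prefix [-> /code_guard_prefix [->]]].
by move=> /(code_seq_prefix (@code_ord_prefix _)) [-> /code_ord_prefix [-> ->]].
Qed.

Lemma code_ta_prefix (k : nat) : prefix_code (@code_ta k).
Proof.
move=> [n m I F D] [n' m' I' F' D'] s t; rewrite /code_ta /= -!catA.
move=> /code_nat_prefix [en /code_nat_prefix [em]].
case: n' / en I' F' D' => I' F'; case: m' / em => D'.
move=> /(code_seq_prefix (@code_ord_prefix _)) [->].
move=> /(code_seq_prefix (@code_ord_prefix _)) [->].
by move=> /(code_seq_prefix (@code_trans_prefix _ _ _)) [-> ->].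
Qed.

Lemma code_pair_inj : injective code_pair.
Proof.
move=> [k A B] [k' A' B']; rewrite /code_pair /=.
move=> /code_nat_prefix [ek]; case: k' / ek A' B' => A' B'.
move=> /code_ta_prefix [-> eB].
by have [->] := @code_ta_prefix _ B B' [::] [::] (congr1 (cat^~ [::]) eB).
Qed.

(* Main.v *)
Require Import Defs.
From HB Require Import structures.
From mathcomp Require Import all_boot all_order all_algebra.
From mathcomp Require Import boolp classical_sets reals.
From mathcomp Require Import ring lra zify.

Set Implicit Arguments.
Unset Strict Implicit.
Unset Printing Implicit Defensive.

Import Order.TTheory GRing.Theory Num.Theory.
Local Open Scope ring_scope.

(** Delays are attached to letters, so in a shuffle the first automaton can pick
    scattered letters of a word and test the sum of their delays, while the
    second one checks that exactly these letters are missing. A word made of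
    blocks of fixed shape, one block per step, encodes the run of a machine with
    real registers: the delays are the register values, and a step is a system
    of linear equations between the delays of consecutive blocks. After a marker
    letter, the shuffle contains the block words violating some equation; words
    not of the shape "marker, blocks" are added by the second automaton, which
    is harmless because a word with two markers never has that shape.

    If every block word violates an equation, the shuffle is an untimed regular
    language. If a block word violates none, then moving the delay of the marker
    slightly yields a word of the shuffle which no timed automaton can tell from
    that block word, provided that all durations of prefixes are non-integral;
    so the shuffle is not timed regular.

    Two registers hold the halves of a tape as fractions in a suitable base. The
    equations depend on a parameter x only through constants of guards, and
    these are coded in unary, so the code of the pair is a binary word with
    holes, filled by x ones. The machine guesses such a word with holes, checks
    that its number (in base 4) is x, fills the holes with x ones and runs the
    alleged decision procedure on the result. When x is the number of the
    template of the pair itself, the procedure is run on the code of the pair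
    simulating it, and its answer is wrong. *)

(** * Languages with finitely many residuals *)

Definition recognizable (T : Type) (P : set (seq T)) : Prop :=
  exists (Q : finType) (f : seq T -> Q),
    forall u v, f u = f v -> forall s, P (u ++ s) -> P (v ++ s).

Section Recognizable.
Local Open Scope classical_set_scope.
Variable T : eqType.
Implicit Types (P : set (seq T)) (u v s w : seq T).

Lemma recognizableT : recognizable [set: seq T].
Proof. by exists unit, (fun=> tt). Qed.

Lemma recognizableC P : recognizable P -> recognizable (~` P).
Proof.
move=> [Q [f fP]]; exists Q, f => u v uv s nPu Pv.
by apply: nPu; apply: fP Pv.
Qed.

Lemma recognizableI P P' :
  recognizable P -> recognizable P' -> recognizable (P `&` P').
Proof.
move=> [Q [f fP]] [Q' [f' fP']]; exists (Q * Q')%type, (fun u => (f u, f' u)).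
by move=> u v [/fP uv /fP' uv'] s [/uv Pv /uv' P'v].
Qed.

Lemma recognizableU P P' :
  recognizable P -> recognizable P' -> recognizable (P `|` P').
Proof.
move=> rP rP'; rewrite -(setCK (P `|` P')) setCU.
by apply/recognizableC/recognizableI; exact: recognizableC.
Qed.

Lemma recognizable_bigcup (I : finType) (P : I -> set (seq T)) :
  (forall i, recognizable (P i)) -> recognizable (\bigcup_i P i).
Proof.
move=> rP; have -> : [set: I] = [set` predT] by apply/seteqP.
rewrite bigcup_pred; elim/big_ind: _ => // [|*]; last exact: recognizableU.
by rewrite -setCT; exact/recognizableC/recognizableT.
Qed.

Lemma recognizable_mem (a : T) : recognizable [set u : seq T | a \in u].
Proof.
exists bool, (fun u => a \in u) => u v uv s /=.
by rewrite !mem_cat uv.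
Qed.

Lemma recognizable_set1 w : recognizable [set w].
Proof.
exists (option 'I_(size w).+1),
  (fun u => if prefix u w then Some (inord (size u)) else None) => u v + s /= uw.
have pu : prefix u w by rewrite -uw prefix_prefix.
rewrite pu; case: ifP => // pv [] /(congr1 val) /=.
rewrite !inordK ?ltnS ?size_prefix // => uv; suff -> : v = u by [].
have /prefixP[v' /eqP] := pv.
by rewrite -uw eqseq_cat // => /andP[/eqP].
Qed.

Lemma cat_eq_cat (w1 w2 u s : seq T) : w1 ++ w2 = u ++ s ->
  (exists2 v, u = w1 ++ v & w2 = v ++ s) \/ (exists2 v, w1 = u ++ v & s = v ++ w2).
Proof.
elim: w1 u => [|a w1 IH] [|b u] /=.
- by move=> ->; left; exists [::].
- by move=> ->; left; exists (b :: u).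
- by move=> <-; right; exists (a :: w1).
move=> [-> /IH [[v -> ->]|[v -> ->]]]; [left|right]; by exists v.
Qed.

Lemma recognizable_cat P P' : recognizable P -> recognizable P' ->
  recognizable [set u1 ++ u2 | u1 in P & u2 in P'].
Proof.
move=> [Q [f fP]] [Q' [f' fP']].
pose tails u : {set Q'} :=
  [set q | `[< exists u1 u2, [/\ u = u1 ++ u2, P u1 & f' u2 = q] >]]%SET.
exists (Q * {set Q'})%type, (fun u => (f u, tails u)).
move=> u v [fuv /setP tuv] s [w1 Pw1 [w2 P'w2 /cat_eq_cat[]]].
  move=> [z uz w2z].
  have : f' z \in tails u by rewrite inE; apply/asboolP; exists w1, z.
  rewrite tuv inE => /asboolP[v1 [v2 [-> Pv1 v2z]]].
  exists v1 => //; exists (v2 ++ s); last by rewrite catA.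
  by apply: fP' (esym v2z) _ _; rewrite -w2z.
move=> [z w1z ->]; exists (v ++ z); first by apply: fP fuv _ _; rewrite -w1z.
by exists w2; rewrite ?catA.
Qed.

End Recognizable.

Definition chain (E : Type) (init fin : pred E) (next : rel E) (es : seq E) : bool :=
  if es is e :: s then [&& init e, path next e s & fin (last e s)] else false.

Lemma recognizable_chain (E : finType) (init fin : pred E) (next : rel E) :
  recognizable (chain init fin next).
Proof.
exists (option (bool * E)), (fun es =>
  if es is e :: s then Some (init e && path next e s, last e s) else None).
move=> [|e u] [|d v] // [uv el] s /=; rewrite !cat_path !last_cat.
by rewrite el 3!andbA uv -!andbA.
Qed.

Section Substitution.
Local Open Scope classical_set_scope.
Variables (E : finType) (T : choiceType) (image_of : E -> seq T).

Definition substitute (es : seq E) : seq T := flatten [seq image_of e | e <- es].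

Lemma substitute_cat es1 es2 :
  substitute (es1 ++ es2) = substitute es1 ++ substitute es2.
Proof. by rewrite /substitute map_cat flatten_cat. Qed.

(* The possible overhangs of a prefix of a substituted word over a product of
   images of letters. *)
Definition image_prefixes : seq (seq T) :=
  [::] :: [seq take i (image_of e) | e <- enum E, i <- iota 0 (size (image_of e))].

Lemma take_image_prefixes e i :
  (i < size (image_of e))%N -> take i (image_of e) \in image_prefixes.
Proof.
move=> ie; rewrite inE; apply/orP; right; apply/allpairsPdep.
by exists e, i; rewrite mem_enum mem_iota.
Qed.

Lemma substitute_split es u s : substitute es = u ++ s ->
  exists es1 es2 v, [/\ es = es1 ++ es2, u = substitute es1 ++ v,
    substitute es2 = v ++ s & v \in image_prefixes].
Proof.
elim: es u => [|e es IH] u.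
  by case: u => // es0; exists [::], [::], [::]; rewrite mem_head.
rewrite -[substitute _]/(image_of e ++ substitute es) => /cat_eq_cat[].
  move=> [u' -> /IH[es1 [es2 [v [-> -> e2 vp]]]]].
  by exists (e :: es1), es2, v; split=> //; exact: catA.
move=> [[|a v] eu ->].
  exists [:: e], es, [::]; split; rewrite ?mem_head //.
  by rewrite /substitute /= eu !cats0.
exists [::], (e :: es), u; split=> //; first by rewrite catA -eu.
rewrite -(take_size_cat (a :: v) (erefl (size u))) -eu take_image_prefixes //.
by rewrite eu size_cat addnS ltnS leq_addr.
Qed.

Lemma recognizable_substitute (P : set (seq E)) :
  recognizable P -> recognizable (substitute @` P).
Proof.
move=> [Q [f fP]].
pose residuals u : {set Q * seq_sub image_prefixes} := [set x |
  `[< exists2 es, u = substitute es ++ val x.2 & f es = x.1 >]]%SET.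
exists {set Q * seq_sub image_prefixes}, residuals.
move=> u v /setP ruv s [es Pes /substitute_split[es1 [es2 [w [ees eu e2 wp]]]]].
have : (f es1, SeqSub wp) \in residuals u by rewrite inE; apply/asboolP; exists es1.
rewrite ruv inE => /asboolP[es1' /= -> f1].
exists (es1' ++ es2); last by rewrite substitute_cat e2 catA.
by apply: fP (esym f1) _ _; rewrite -ees.
Qed.

End Substitution.

Definition timings (R : realType) (k : nat) (P : set (seq 'I_k)) :
    set (seq (R * 'I_k)) :=
  [set w | timed_word w /\ P (unzip2 w)]%classic.

Arguments timings R {k} P.

Section UntimedAutomaton.
Variables (R : realType) (k : nat) (P : set (seq 'I_k)).
Variables (Q : finType) (f : seq 'I_k -> Q).
Hypothesis f_residual : forall u v, f u = f v -> forall s, P (u ++ s) -> P (v ++ s).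

Definition reachable_step (x : Q * 'I_k * Q) : bool :=
  `[< exists2 u, f u = x.1.1 & f (rcons u x.1.2) = x.2 >].

Definition untimed_automaton : timed_automaton k :=
  @TimedAutomaton k #|Q| 0 [:: enum_rank (f [::])]
    [seq enum_rank q | q <- enum Q & `[< exists2 u, f u = q & P u >]]
    [seq Transition (enum_rank x.1.1) x.1.2 (GTrue 0) [::] (enum_rank x.2)
      | x <- enum {: Q * 'I_k * Q} & reachable_step x].

Lemma untimed_automaton_sound (w : seq (R * 'I_k)) q v :
  @accepts_from R k untimed_automaton (enum_rank q) v w ->
  exists2 u, f u = q & P (u ++ unzip2 w).
Proof.
elim: w q v => [|[t a] w IH] q v /=.
  move=> /mapP[q']; rewrite mem_filter => /andP[/asboolP[u uq Pu] _].
  by move/enum_rank_inj => ->; exists u; rewrite ?cats0.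
rewrite has_map => /hasP[[[p a'] p']]; rewrite mem_filter.
move=> /andP[/asboolP[u /= up ua] _].
move=> /and3P[/eqP/enum_rank_inj pq /eqP aa] /IH[u' u'p' Pu'].
by exists u; rewrite ?up // -cat_rcons -aa; apply: f_residual Pu'; rewrite ua.
Qed.

Lemma untimed_automaton_complete u v (w : seq (R * 'I_k)) :
  P (u ++ unzip2 w) -> @accepts_from R k untimed_automaton (enum_rank (f u)) v w.
Proof.
elim: w u v => [|[t a] w IH] u v /=.
  rewrite cats0 => Pu; apply/mapP; exists (f u) => //.
  by rewrite mem_filter mem_enum andbT; apply/asboolP; exists u.
rewrite -cat_rcons => /IH acc; rewrite has_map; apply/hasP.
exists (f u, a, f (rcons u a)); last by rewrite /= !eqxx acc.
by rewrite mem_filter mem_enum andbT; apply/asboolP; exists u.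
Qed.

Lemma untimed_automatonE : ta_lang R untimed_automaton = timings R P.
Proof.
apply/seteqP; split=> w -[tw acc]; split=> //.
  move: acc; rewrite /= orbF => /untimed_automaton_sound[u u0].
  exact: (f_residual (v := [::]) u0).
by rewrite /= orbF (untimed_automaton_complete (u := [::])).
Qed.

End UntimedAutomaton.

Lemma recognizable_timed_regular (R : realType) (k : nat) (P : set (seq 'I_k)) :
  recognizable P -> timed_regular (timings R P).
Proof.
move=> [Q [f fP]]; exists (untimed_automaton P f).
by rewrite untimed_automatonE.
Qed.

(** * Regions, shuffles and tests on sums of delays *)

Definition duration (R : realType) (k : nat) (w : seq (R * 'I_k)) : R :=
  \sum_(ta <- w) ta.1.

Section Regions.
Variable R : realType.

Definition same_region (a b : R) : Prop :=
  forall c : nat, (a < c%:R) = (b < c%:R) /\ (c%:R < a) = (c%:R < b).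

Definition gap_above (f h : R) : Prop := forall c : nat, c%:R <= f \/ f + h <= c%:R.

Lemma gap_above_same_region f h a b :
  gap_above f h -> f < a < f + h -> f < b < f + h -> same_region a b.
Proof.
by move=> gap /andP[fa ah] /andP[fb bh] c; case: (gap c) => hc; split;
  apply/idP/idP; lra.
Qed.

Lemma gap_above_le f h h' : gap_above f h -> h' <= h -> gap_above f h'.
Proof. by move=> gap h'h c; case: (gap c) => hc; [left|right; lra]. Qed.

Lemma exists_gap_above f : exists2 h, 0 < h & gap_above f h.
Proof.
exists ((Num.floor f + 1)%:~R - f); first by rewrite subr_gt0 floorD1_gt.
move=> c; have [|fc] := leP c%:R f; [by left | right].
by rewrite addrC subrK [c%:R]pmulrn ler_int lezD1 floor_lt_int.
Qed.

Lemma exists_common_gap (F : seq R) :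
  exists2 h, 0 < h & forall f, f \in F -> gap_above f h.
Proof.
elim: F => [|f F [h h0 gapF]]; first by exists 1.
have [h' h'0 gapf] := exists_gap_above f.
exists (Num.min h h'); first by rewrite lt_min h0.
move=> g; rewrite inE => /predU1P[->|/gapF gapg].
  by apply: gap_above_le gapf _; rewrite ge_min lexx orbT.
by apply: gap_above_le gapg _; rewrite ge_min lexx.
Qed.

Lemma cmp_sem_region o (a b : R) (c : nat) :
  same_region a b -> cmp_sem o a c%:R = cmp_sem o b c%:R.
Proof.
move=> /(_ c)[lt_ab gt_ab]; case: o => //=; rewrite ?[_ == c%:R]eq_le ?leNgt.
all: by rewrite ?lt_ab ?gt_ab.
Qed.

Lemma guard_sem_region m (v v' : 'I_m -> R) g :
  (forall x, v x = v' x \/ same_region (v x) (v' x)) ->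
  guard_sem v g = guard_sem v' g.
Proof.
move=> vv'; elim: g => //= [x o c|g -> //|g -> h -> //|g -> h -> //].
by have [->//|] := vv' x; apply: cmp_sem_region.
Qed.

Lemma accepts_from_region k (A : timed_automaton k) q (v v' : _ -> R) w :
  (forall x, v x = v' x \/ forall i, (i < size w)%N ->
     same_region (v x + duration (take i.+1 w)) (v' x + duration (take i.+1 w))) ->
  @accepts_from R k A q v w = accepts_from q v' w.
Proof.
elim: w q v v' => // -[t a] w IH q v v' vv' /=.
apply: eq_has => e; do 2!congr andb; congr andb.
  apply: guard_sem_region => x; case: (vv' x) => [xx|/(_ 0%N isT)].
    by left; rewrite /elapse xx.
  by rewrite /duration /= take0 big_seq1 /elapse; right.
apply: IH => x; rewrite /reset; case: ifP => _; first by left.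
case: (vv' x) => [xx|reg]; first by left; rewrite /elapse xx.
right=> i iw; have := reg i.+1 iw.
by rewrite /duration [take i.+2 _]/= big_cons /elapse !addrA.
Qed.

Lemma ta_lang_region k (A : timed_automaton k) (t d : R) a w :
  (forall i, same_region (t + duration (take i w)) (t + d + duration (take i w))) ->
  0 < t -> 0 < d ->
  ta_lang R A ((t, a) :: w) <-> ta_lang R A ((t + d, a) :: w).
Proof.
move=> reg t0 d0; rewrite /ta_lang /= /timed_word /= t0 addr_gt0 //.
suff -> : has (fun q => accepts_from q (fun=> 0) ((t, a) :: w)) (ta_init A) =
  has (fun q => accepts_from q (fun=> 0) ((t + d, a) :: w)) (ta_init A) by [].
apply: eq_has => q; transitivity (accepts_from q (fun=> d) ((t, a) :: w)).
  apply: accepts_from_region => x; right=> i _.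
  rewrite /duration /= big_cons add0r /= addrA [d + t]addrC; exact: reg.
rewrite /=; apply: eq_has => e.
suff -> : elapse (fun=> d) t = elapse (fun _ : 'I_(ta_clocks A) => 0) (t + d) by [].
by apply/funext => x; rewrite /elapse add0r addrC.
Qed.

(* The second delay [tau] moves the durations of all longer prefixes strictly
   inside a gap between integers. *)
Lemma ta_lang_shift k (theta : R) (a b : 'I_k) w : 0 < theta < 1 ->
  exists tau d, [/\ 0 < tau, 0 < d & forall A : timed_automaton k,
    ta_lang R A [:: (theta, a), (tau, b) & w] <->
    ta_lang R A [:: (theta + d, a), (tau, b) & w]].
Proof.
move=> /andP[theta0 theta1].
have [h h0 gap] := exists_common_gap
  [seq theta + duration (take i w) | i <- iota 0 (size w).+1].
have {}gap i : gap_above (theta + duration (take i w)) h.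
  apply: gap; apply/mapP; exists (minn i (size w)); last by rewrite take_min take_size.
  by rewrite mem_iota ltnS geq_minr.
exists (h / 2), (h / 4); split; [by rewrite divr_gt0 | by rewrite divr_gt0 |].
move=> A; apply: ta_lang_region; rewrite ?divr_gt0 //.
case=> [|i]; rewrite /duration ?take0 ?big_nil ?addr0 /=; last first.
  by rewrite big_cons /= -/(duration _); apply: gap_above_same_region (gap i) _ _; lra.
have thetah : theta + h <= 1.
  by have := gap 0%N 1%N; rewrite take0 /duration big_nil; case; lra.
apply: (@gap_above_same_region 0 1); try lra.
by move=> [|c]; [left | right; rewrite add0r ler1n].
Qed.

Lemma isolated_delay_not_timed_regular k (L : set (seq (R * 'I_k))) theta a b w :
  0 < theta < 1 ->
  (forall t tau, 0 < t -> 0 < tau ->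
     L [:: (t, a), (tau, b) & w] <-> t <> theta) ->
  ~ timed_regular L.
Proof.
move=> theta01 LE [A LA]; have [tau [d [tau0 d0]]] := ta_lang_shift a b w theta01.
by move=> /(_ A); rewrite -LA !LE; lra.
Qed.

End Regions.

Section Shuffle.
Variable T : Type.
Implicit Types x y z : seq T.

Lemma shuffle_word_cat x y z x' y' z' :
  shuffle_word x y z -> shuffle_word x' y' z' ->
  shuffle_word (x ++ x') (y ++ y') (z ++ z').
Proof.
move=> [xs [ys [exy -> -> ->]]] [xs' [ys' [exy' -> -> ->]]].
exists (xs ++ xs'), (ys ++ ys').
by rewrite !size_cat !flatten_cat zip_cat // map_cat flatten_cat exy exy'.
Qed.

Lemma shuffle_word0l y : shuffle_word [::] y y.
Proof. by exists [:: [::]], [:: y]; rewrite /= cats0. Qed.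

Lemma shuffle_word0r x : shuffle_word x [::] x.
Proof. by exists [:: x], [:: [::]]; rewrite /= !cats0. Qed.

Lemma shuffle_word_consl a x y z :
  shuffle_word x y z -> shuffle_word (a :: x) y (a :: z).
Proof. exact: shuffle_word_cat (shuffle_word0r [:: a]). Qed.

Lemma shuffle_word_consr a x y z :
  shuffle_word x y z -> shuffle_word x (a :: y) (a :: z).
Proof. exact: shuffle_word_cat (shuffle_word0l [:: a]). Qed.

Lemma shuffle_word_nil_inv x y : shuffle_word x y [::] -> x = [::] /\ y = [::].
Proof.
move=> [xs [ys [sz -> -> /esym]]]; elim: xs ys sz => [|x' xs IH] [|y' ys] //= [/IH].
by move=> + /nilP; rewrite !cat_nilp => + /andP[/andP[/nilP-> /nilP->] /nilP].
Qed.

Lemma shuffle_word_cons_inv x y a z : shuffle_word x y (a :: z) ->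
  (exists2 x', x = a :: x' & shuffle_word x' y z) \/
  (exists2 y', y = a :: y' & shuffle_word x y' z).
Proof.
move=> [xs [ys [sz -> ->]]]; elim: xs ys sz => [|[|b x'] xs IH] [|y' ys] //= [sz].
  case: y' => [/(IH ys sz)//|b y' [-> ->]]; right; exists (y' ++ flatten ys) => //.
  by exists ([::] :: xs), (y' :: ys); rewrite /= sz.
move=> [-> ->]; left; exists (x' ++ flatten xs) => //.
by exists (x' :: xs), (y' :: ys); rewrite /= sz.
Qed.

Lemma shuffle_word_nil y z : shuffle_word [::] y z -> y = z.
Proof.
elim: z y => [|a z IH] y; first by case/shuffle_word_nil_inv.
by case/shuffle_word_cons_inv => -[y'] // -> /IH->.
Qed.

Lemma all_shuffle_word (p : pred T) x y z :
  shuffle_word x y z -> all p z = all p x && all p y.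
Proof.
elim: z x y => [|a z IH] x y; first by case/shuffle_word_nil_inv => -> ->.
by case/shuffle_word_cons_inv => -[x' -> /IH /= ->]; case: (p a) => //=; rewrite andbF.
Qed.

Lemma shuffle_word_cat_inv x y z1 z2 : shuffle_word x y (z1 ++ z2) ->
  exists x1 x2 y1 y2, [/\ x = x1 ++ x2, y = y1 ++ y2,
    shuffle_word x1 y1 z1 & shuffle_word x2 y2 z2].
Proof.
elim: z1 x y => [|a z1 IH] x y.
  by exists [::], x, [::], y; split=> //; exact: shuffle_word0l.
case/shuffle_word_cons_inv => -[w -> /IH[x1 [x2 [y1 [y2 [-> -> sh1 sh2]]]]]].
  by exists (a :: x1), x2, y1, y2; split=> //; exact: shuffle_word_consl.
by exists x1, x2, (a :: y1), y2; split=> //; exact: shuffle_word_consr.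
Qed.

End Shuffle.

Section ShuffleMap.
Variables (S T : Type) (f : S -> T).

Lemma shuffle_word_map_inv x y s : shuffle_word x y (map f s) ->
  exists u v, [/\ x = map f u, y = map f v & shuffle_word u v s].
Proof.
elim: s x y => [|a s IH] x y /=.
  case/shuffle_word_nil_inv => -> ->; exists [::], [::]; split=> //.
  exact: shuffle_word0l.
move=> /(@shuffle_word_cons_inv T)[] [w -> /IH[u [v [-> -> sh]]]].
  by exists (a :: u), v; split=> //; exact: shuffle_word_consl.
by exists u, (a :: v); split=> //; exact: shuffle_word_consr.
Qed.

Lemma shuffle_word_map_filter (p : pred S) s :
  shuffle_word (map f (filter p s)) (map f (filter (predC p) s)) (map f s).
Proof.
elim: s => [|a s IH] /=; first exact: shuffle_word0l.
by case: (p a) => /=; [exact: shuffle_word_consl | exact: shuffle_word_consr].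
Qed.

End ShuffleMap.

Lemma shuffle_word_filter_uniq (T : eqType) (p : pred T) (x s : seq T) :
  uniq s -> shuffle_word x (filter (predC p) s) s -> x = filter p s.
Proof.
elim: s x => [|a s IH] x /=; first by move=> _ /shuffle_word_nil_inv[].
move=> /andP[nas us]; case pa: (p a) => /= /(@shuffle_word_cons_inv T)[].
- by move=> [x' -> /(IH _ us) ->].
- move=> [y ey _]; suff : a \in filter (predC p) s.
    by rewrite mem_filter (negbTE nas) andbF.
  by rewrite ey mem_head.
- move=> [x' _ /(all_shuffle_word (predC1 a))].
  have /allP-> : {in s, forall b, predC1 a b}.
    by move=> b bs; apply: contraNneq nas => <-.
  by rewrite /= eqxx andbF.
by move=> [y [<-] /(IH _ us)].
Qed.

Record sum_test := SumTest { with_marker : bool; target : nat }.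

Definition passes (R : realType) (k : nat) (c : sum_test) (t : R)
    (w : seq (R * 'I_k)) : bool :=
  t *+ with_marker c + duration w == (target c)%:R.

Section ViolationAutomaton.
Variables (k : nat) (m : 'I_k) (W : finType).
Variables (letters : W -> seq 'I_k) (test : W -> sum_test).
Hypothesis letters_neq0 : forall i, letters i != [::].

Let max_size := (\max_i size (letters i))%N.
Let position : finType := (W * 'I_max_size.+1)%type.
Let state : finType := option position.
Let code (q : state) : 'I_#|{: state}| := enum_rank q.

(* In state [Some (i, j)] the first [j] letters of [letters i] have been read;
   the only clock measures the sum under test. *)
Definition violation_automaton : timed_automaton k :=
  @TimedAutomaton k #|{: state}| 1 [:: code None]
    (code None :: [seq code (Some (i, inord (size (letters i)))) | i <- enum W])
    ([seq Transition (code None) m (GTrue 1)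
            (if with_marker (test i) then [::] else [:: ord0])
            (code (Some (i, ord0))) | i <- enum W] ++
     [seq Transition (code (Some p)) (nth m (letters p.1) p.2)
            (if p.2.+1 == size (letters p.1)
             then GNot (GAtom ord0 CEq (target (test p.1))) else GTrue 1)
            [::] (code (Some (p.1, inord p.2.+1)))
     | p : position <- enum {: position} & (p.2 < size (letters p.1))%N]).

Variable R : realType.
Implicit Types (v : 'I_1 -> R) (w : seq (R * 'I_k)).

Let accepts q v w := @accepts_from R k violation_automaton (code q) v w.

Lemma ltn_max_size i j : (j <= size (letters i))%N -> (j < max_size.+1)%N.
Proof. by move=> ji; rewrite ltnS; apply: leq_trans ji (leq_bigmax i). Qed.

Lemma violation_automaton_read i (j : 'I_max_size.+1) v t a w :
  accepts (Some (i, j)) v ((t, a) :: w) =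
  [&& (j < size (letters i))%N, nth m (letters i) j == a,
      (j.+1 == size (letters i)) ==> (v ord0 + t != (target (test i))%:R)
    & accepts (Some (i, inord j.+1)) (elapse v t) w].
Proof.
rewrite /accepts /= has_cat !has_map (eq_has (a2 := pred0)); last first.
  by move=> i'; apply/andP => -[/eqP/enum_rank_inj].
rewrite has_pred0 /=; apply/hasP/and4P => [[[i' j']]|[ji aj sum_ok acc]].
  rewrite mem_filter => /andP[/= j'i _] /and4P[/eqP/enum_rank_inj[<- <-] -> g ->].
  by split=> //; move: g; case: ifP.
exists (i, j); first by rewrite mem_filter ji mem_enum.
by apply/and4P; split=> //=; move: sum_ok; case: ifP.
Qed.

Lemma violation_automaton_tail i (j : 'I_max_size.+1) v w :
  (j <= size (letters i))%N ->
  accepts (Some (i, j)) v w = (unzip2 w == drop j (letters i)) &&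
  ((j < size (letters i))%N ==> (v ord0 + duration w != (target (test i))%:R)).
Proof.
elim: w j v => [|[t a] w IH] j v ji.
  rewrite /accepts /= inE (inj_eq enum_rank_inj) /=.
  have -> : (code (Some (i, j)) \in
      [seq code (Some (i, inord (size (letters i)))) | i <- enum W]) =
      (j == size (letters i) :> nat).
    apply/mapP/eqP => [[i' _ /enum_rank_inj[-> ->]]|ej].
      by rewrite inordK // (ltn_max_size (i := i')).
    exists i; rewrite ?mem_enum //; congr (code (Some (i, _))); apply/val_inj.
    by rewrite /= inordK // (ltn_max_size (i := i)).
  rewrite [[::] == _]eq_sym -size_eq0 size_drop subn_eq0 eqn_leq ji /=.
  by case: (ltnP j).
rewrite violation_automaton_read; have [ji'|ij] := ltnP; last first.
  by rewrite drop_oversize.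
rewrite (drop_nth m) // eqseq_cons [nth _ _ _ == a]eq_sym /= -andbA; congr andb.
rewrite IH inordK ?(ltn_max_size (i := i)) // /elapse /duration big_cons addrA.
case: eqP => [ej|/eqP ej]; last by rewrite ltn_neqAle ej ji'.
rewrite ej ltnn drop_size andbT andbC.
by case: w {IH} => //=; rewrite big_nil addr0.
Qed.

Lemma violation_automatonE w :
  ta_lang R violation_automaton w <->
  timed_word w /\ (w = [::] \/ exists i t w', [/\ w = (t, m) :: w',
     unzip2 w' = letters i & ~~ passes (test i) t w']).
Proof.
have start i t w' : accepts (Some (i, ord0))
    (reset (elapse (fun=> 0) t) (if with_marker (test i) then [::] else [:: ord0])) w' =
    (unzip2 w' == letters i) && ~~ passes (test i) t w'.
  rewrite violation_automaton_tail // drop0 lt0n size_eq0 letters_neq0 /= /passes.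
  by rewrite /reset /elapse; case: with_marker; rewrite ?inE /= add0r.
rewrite /ta_lang /= orbF; split=> -[tw]; last first.
  case=> [->|[i [t [w' [ew wl viol]]]]]; first by rewrite /= mem_head.
  split=> //; rewrite ew /= has_cat !has_map; apply/orP; left; apply/hasP.
  exists i; rewrite -?enumT ?mem_enum //= !eqxx /=.
  by rewrite -[accepts_from _ _ _]/(accepts _ _ _) start wl eqxx.
case: w tw => [|[t a] w] tw; [by split=> //; left | rewrite /= has_cat !has_map].
case/orP=> /hasP[p _] /=; last by case/andP => /eqP/enum_rank_inj.
move=> /andP[_ /andP[/eqP <-]]; rewrite -[accepts_from _ _ _]/(accepts _ _ _) start.
by move=> /andP[/eqP wl viol]; split=> //; right; exists p, t, w.
Qed.

End ViolationAutomaton.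

(** * Block words *)

Lemma cat_separated_inj (T : Type) (h : pred T) (a a' c c' : seq T) :
  all (predC h) a -> all (predC h) a' -> all h (take 1 c) -> all h (take 1 c') ->
  a ++ c = a' ++ c' -> a = a' /\ c = c'.
Proof.
move=> + + hc hc'; elim: a a' => [|x a IH] [|x' a'] //=.
- by move=> _ /andP[nx _] ec; move: hc; rewrite ec /= (negbTE nx).
- by move=> /andP[nx _] _ ec; move: hc'; rewrite -ec /= (negbTE nx).
by move=> /andP[_ na] /andP[_ na'] [-> /(IH _ na na')[-> ->]].
Qed.

Lemma map_eq_cat3 (T T' : Type) (f : T -> T') (u : seq T) v1 v2 v3 :
  map f u = v1 ++ v2 ++ v3 -> exists u1 u2 u3,
    [/\ u = u1 ++ u2 ++ u3, map f u1 = v1, map f u2 = v2 & map f u3 = v3].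
Proof.
move=> e; exists (take (size v1) u), (take (size v2) (drop (size v1) u)),
  (drop (size v2) (drop (size v1) u)).
by rewrite !cat_take_drop !map_take !map_drop e take_size_cat // drop_size_cat //
  take_size_cat // drop_size_cat.
Qed.

Lemma unzip2_eq_map (A : eqType) (B C : Type) (b0 : B) (g : A -> C) (s : seq A)
    (w : seq (B * C)) : uniq s -> unzip2 w = map g s ->
  exists f : A -> B, w = [seq (f a, g a) | a <- s].
Proof.
elim: s w => [|a s IH] [|[b c] w] //=.
move=> /andP[nas us] [-> /(IH _ us)[f ->]].
exists (fun x => if x == a then b else f x); rewrite eqxx; congr cons.
by apply/eq_in_map => x xs; rewrite ifN //; apply: contraNneq nas => <-.
Qed.

Section Letters.
Variables E S : finType.

Definition letter : finType := option (E * option S).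
Definition alphabet_size := #|{: letter}|.
Definition marker : 'I_alphabet_size := enum_rank (None : letter).
Definition header (e : E) : 'I_alphabet_size := enum_rank (Some (e, None) : letter).
Definition slot (x : E * S) : 'I_alphabet_size :=
  enum_rank (Some (x.1, Some x.2) : letter).

Definition is_header (a : 'I_alphabet_size) : bool :=
  if enum_val a is Some (_, None) then true else false.

Lemma slot_inj : injective slot.
Proof. by move=> [e s] [e' s'] /enum_rank_inj[-> ->]. Qed.

Lemma header_inj : injective header.
Proof. by move=> e e' /enum_rank_inj[->]. Qed.

Lemma is_header_header e : is_header (header e).
Proof. by rewrite /is_header enum_rankK. Qed.

Lemma is_header_slot x : is_header (slot x) = false.
Proof. by rewrite /is_header enum_rankK. Qed.

Lemma marker_header e : (marker == header e) = false.
Proof. by apply/eqP => /enum_rank_inj. Qed.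

Lemma marker_slot x : (marker == slot x) = false.
Proof. by apply/eqP => /enum_rank_inj. Qed.

(* A window lists consecutive instructions, each with the slots that are taken
   out of the block of that instruction. *)
Definition window := seq (E * {set S}).

Definition block (e : E) := header e :: [seq slot (e, s) | s <- enum S].
Definition punctured_block (p : E * {set S}) :=
  header p.1 :: [seq slot (p.1, s) | s <- enum S & s \notin p.2].
Definition punctured (W : window) := flatten [seq punctured_block p | p <- W].
Definition removed (W : window) : seq (E * S) :=
  flatten [seq [seq (p.1, s) | s <- enum S & s \in p.2] | p : E * {set S} <- W].
Definition full (es : seq E) : window := [seq (e, finset.set0) | e <- es].
Definition embed es1 W es2 : window := full es1 ++ W ++ full es2.

Lemma punctured_cat W W' : punctured (W ++ W') = punctured W ++ punctured W'.
Proof. by rewrite /punctured map_cat flatten_cat. Qed.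

Lemma punctured_full es : punctured (full es) = substitute block es.
Proof.
rewrite /punctured /full -map_comp; congr flatten; apply: eq_map => e /=.
rewrite /punctured_block /block /=; congr cons; congr map.
by rewrite (@eq_filter _ _ predT) ?filter_predT // => s; rewrite inE.
Qed.

Lemma removed_cat W W' : removed (W ++ W') = removed W ++ removed W'.
Proof. by rewrite /removed map_cat flatten_cat. Qed.

Lemma removed_full es : removed (full es) = [::].
Proof.
elim: es => // e es IH; rewrite /removed /= -/(removed (full es)) IH cats0.
by rewrite (@eq_filter _ _ pred0) ?filter_pred0 // => s; rewrite inE.
Qed.

Lemma removed_embed es1 W es2 : removed (embed es1 W es2) = removed W.
Proof. by rewrite !removed_cat !removed_full cats0. Qed.

Lemma punctured_embed es1 W es2 : punctured (embed es1 W es2) =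
  substitute block es1 ++ punctured W ++ substitute block es2.
Proof. by rewrite !punctured_cat !punctured_full. Qed.

Lemma unzip1_embed es1 W es2 : unzip1 (embed es1 W es2) = es1 ++ unzip1 W ++ es2.
Proof. by rewrite /unzip1 !map_cat -!map_comp !map_id. Qed.

Lemma mem_removed1 (e : E) (X : {set S}) y :
  (y \in removed [:: (e, X)]) = (y.1 == e) && (y.2 \in X).
Proof.
rewrite /removed /= cats0; apply/mapP/andP => [[s]|].
  by rewrite mem_filter => /andP[sX _] ->; rewrite /= eqxx.
by case: y => e' s /= [/eqP-> sX]; exists s; rewrite // mem_filter sX mem_enum.
Qed.

Lemma marker_punctured W : marker \notin punctured W.
Proof.
apply/negP => /flatten_mapP[p _]; rewrite inE marker_header /=.
by move=> /mapP[s _ /eqP]; rewrite marker_slot.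
Qed.

End Letters.

Section TimedBlocks.
Variables (R : realType) (E S : finType).

(* An instruction with the delays of the slots of its block. *)
Definition valuation := (E * (S -> R))%type.

Implicit Types (e : E) (s : S) (v : valuation) (vs : seq valuation).
Implicit Types (bs : seq (R * valuation)) (W : window E S).
Implicit Types x y w : seq (R * 'I_(alphabet_size E S)).

Definition timed_slot v s := (v.2 s, slot (v.1, s)).
Definition timed_block (b : R * valuation) :=
  (b.1, header S b.2.1) :: [seq timed_slot b.2 s | s <- enum S].
Definition timed_blocks bs := flatten [seq timed_block b | b <- bs].
Definition timed_removed vs W :=
  flatten [seq [seq timed_slot q.1 s | s <- enum S & s \in q.2.2]
          | q : valuation * (E * {set S}) <- zip vs W].
Definition positive v : bool := [forall s, 0 < v.2 s].

Lemma timed_word_blocks bs : timed_word (timed_blocks bs) =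
  all (fun t => 0 < t) (unzip1 bs) && all positive (unzip2 bs).
Proof.
elim: bs => // b bs IH; rewrite [LHS]all_cat.
rewrite -[all _ (flatten _)]/(timed_word _) IH /= -!andbA.
congr andb; rewrite andbCA; congr andb; congr andb.
rewrite all_map; apply/allP/forallP => pos s; last by move=> _; exact: pos.
by apply: pos; rewrite mem_enum.
Qed.

Lemma unzip2_timed_blocks bs :
  unzip2 (timed_blocks bs) = substitute (@block E S) (unzip1 (unzip2 bs)).
Proof.
rewrite /unzip2 /timed_blocks map_flatten /substitute -!map_comp.
by congr flatten; apply: eq_map => b; rewrite /= -map_comp.
Qed.

Lemma unzip2_eq_blocks w es : unzip2 w = substitute (@block E S) es ->
  exists2 bs, unzip1 (unzip2 bs) = es & w = timed_blocks bs.
Proof.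
elim: es w => [|e es IH] w /=; first by case: w => // _; exists [::].
case: w => [//|[t a] w] /= [-> ew].
pose n := size (enum S).
have [bs <- ebs] : exists2 bs, unzip1 (unzip2 bs) = es & drop n w = timed_blocks bs.
  by apply: IH; rewrite /unzip2 map_drop [map _ _]ew drop_size_cat // size_map.
have [f ef] : exists f : S -> R, take n w = [seq (f s, slot (e, s)) | s <- enum S].
  apply: unzip2_eq_map; rewrite ?enum_uniq //.
  by rewrite /unzip2 map_take [map _ _]ew take_size_cat // size_map.
by exists ((t, (e, f)) :: bs); rewrite // -(cat_take_drop n w) ef ebs.
Qed.

Lemma timed_removed_cat vs vs' W W' : size vs = size W ->
  timed_removed (vs ++ vs') (W ++ W') = timed_removed vs W ++ timed_removed vs' W'.
Proof. by move=> sz; rewrite /timed_removed zip_cat // map_cat flatten_cat. Qed.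

Lemma timed_removed_full vs : timed_removed vs (full S (unzip1 vs)) = [::].
Proof.
elim: vs => // v vs IH; rewrite /timed_removed /= -/(timed_removed vs _) IH cats0.
by rewrite (@eq_filter _ _ pred0) ?filter_pred0 // => s; rewrite inE.
Qed.

Lemma timed_removed_embed vs1 vw vs2 W : unzip1 vw = unzip1 W ->
  timed_removed (vs1 ++ vw ++ vs2) (embed (unzip1 vs1) W (unzip1 vs2)) =
  timed_removed vw W.
Proof.
move=> /(congr1 size); rewrite !size_map => sz.
by rewrite !timed_removed_cat ?size_map // !timed_removed_full cats0.
Qed.

Lemma unzip2_timed_removed vs W : unzip1 vs = unzip1 W ->
  unzip2 (timed_removed vs W) = [seq slot p | p <- removed W].
Proof.
elim: vs W => [|v vs IH] [|[e X] W] //= [<- /IH vW].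
rewrite /timed_removed /removed /= /unzip2 !map_cat [map snd (flatten _)]vW.
by rewrite -!map_comp.
Qed.

Lemma shuffle_timed_blocks bs W : unzip1 (unzip2 bs) = unzip1 W ->
  exists2 y, shuffle_word (timed_removed (unzip2 bs) W) y (timed_blocks bs) &
    unzip2 y = punctured W.
Proof.
elim: bs W => [|[t v] bs IH] [|[e X] W] //=.
  by exists [::] => //; exact: shuffle_word0l.
move=> [<- /IH[y sh yW]].
exists ((t, header S v.1) :: [seq timed_slot v s | s <- enum S & s \notin X] ++ y).
  apply: shuffle_word_consr.
  by apply: shuffle_word_cat sh; exact: shuffle_word_map_filter.
by rewrite /= /unzip2 map_cat [map _ y]yW /punctured /= -map_comp.
Qed.

Lemma shuffle_blocks_head x y bs : shuffle_word x y (timed_blocks bs) ->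
  all (predC (@is_header E S)) (unzip2 x) -> all (@is_header E S) (take 1 (unzip2 y)).
Proof.
case: bs => [/shuffle_word_nil_inv[_ ->]//|b bs].
move=> sh; case: (shuffle_word_cons_inv sh) => -[w -> _].
  by rewrite /= is_header_header.
by rewrite /= take0 is_header_header.
Qed.

Lemma shuffle_timed_blocks_inv x y bs W :
  shuffle_word x y (timed_blocks bs) -> all (predC (@is_header E S)) (unzip2 x) ->
  unzip2 y = punctured W ->
  unzip1 (unzip2 bs) = unzip1 W /\ x = timed_removed (unzip2 bs) W.
Proof.
elim: bs W x y => [|[t v] bs IH] W x y.
  by move=> /shuffle_word_nil_inv[-> ->] _; case: W.
move=> /shuffle_word_cat_inv[x1 [x2 [y1 [y2 [-> -> sh1 sh2]]]]].
rewrite {1}/unzip2 map_cat all_cat => /andP[nh1 nh2].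
case: (shuffle_word_cons_inv sh1) => -[w ew {}sh1]; rewrite ew /= in nh1 *.
  by move: nh1; rewrite is_header_header.
have [u1 [u2 [ex1 eu2 {}sh1]]] := shuffle_word_map_inv sh1; rewrite {}ex1 {}eu2.
case: W => [//|[e X] W]; rewrite /unzip2 map_cat => -[/header_inj<-].
case/(@cat_separated_inj _ (@is_header E S)) => [||||keep rest].
- by rewrite -map_comp all_map; apply/allP => s _ /=; rewrite is_header_slot.
- by rewrite all_map; apply/allP => s _ /=; rewrite is_header_slot.
- exact: shuffle_blocks_head sh2 nh2.
- by case: (W) => //= p W'; rewrite take0 /= is_header_header.
have [-> ->] := IH _ _ _ sh2 nh2 rest; split=> //.
rewrite /timed_removed /=; congr (map _ _ ++ _).
apply: shuffle_word_filter_uniq (enum_uniq _) _.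
suff <- : u2 = filter (predC (mem X)) (enum S) by [].
apply: (@inj_map _ _ (fun s => slot (v.1, s))); first by move=> s s' /slot_inj[].
by rewrite -keep -map_comp.
Qed.

End TimedBlocks.

(** * Regularity of the shuffle *)

Section Equations.
Variables (R : realType) (E S : finType).
Variables (valid : set (seq E)) (Q : finType) (win : Q -> window E S).
Variable test : Q -> sum_test.

Local Notation k := (alphabet_size E S).
Local Notation m := (marker E S).
Local Notation blocks := (substitute (@block E S)).
Implicit Types (theta : R) (vs : seq (valuation R E S)).
Implicit Types (bs : seq (R * valuation R E S)).
Implicit Types (q : Q) (u : seq 'I_k) (x y z : seq (R * 'I_k)).

(* An equation holds at every factor of the word of instructions that fits its
   window. *)
Definition satisfied theta vs : Prop := forall q vs1 vw vs2,
  vs = vs1 ++ vw ++ vs2 -> unzip1 vw = unzip1 (win q) ->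
  passes (test q) theta (timed_removed vw (win q)).

Definition solution theta vs : Prop :=
  [/\ 0 < theta, valid (unzip1 vs), all (@positive R E S) vs & satisfied theta vs].

Definition violation_tester : timed_automaton k :=
  violation_automaton m (fun q => [seq slot p | p <- removed (win q)]) test.

Definition punctured_words : set (seq 'I_k) :=
  (\bigcup_q [set u1 ++ u2 | u1 in range blocks & u2 in
     [set w1 ++ w2 | w1 in [set punctured (win q)] & w2 in range blocks]])%classic.

Definition valid_words : set (seq 'I_k) :=
  [set u1 ++ u2 | u1 in [set [:: m]] & u2 in blocks @` valid]%classic.

Definition filler : set (seq 'I_k) :=
  ([set u : seq _ | m \in u] `&` ~` valid_words `|` punctured_words)%classic.

Definition equation_shuffle : set (seq (R * 'I_k)) :=
  shuffle (ta_lang R violation_tester) (timings R filler).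

Hypothesis valid_recognizable : recognizable valid.

Lemma recognizable_punctured_words : recognizable punctured_words.
Proof.
have recog_blocks : recognizable (range blocks).
  by apply: recognizable_substitute; exact: recognizableT.
apply: recognizable_bigcup => q; apply: recognizable_cat => //.
by apply: recognizable_cat => //; exact: recognizable_set1.
Qed.

Lemma recognizable_filler : recognizable filler.
Proof.
apply: recognizableU recognizable_punctured_words.
apply: recognizableI; first exact: recognizable_mem.
apply/recognizableC/recognizable_cat; first exact: recognizable_set1.
exact: recognizable_substitute.
Qed.

Lemma punctured_wordsP u : punctured_words u <->
  exists q es1 es2, u = punctured (embed es1 (win q) es2).
Proof.
split=> [[q _ [_ [es1 _ <-] [_ [_ -> [_ [es2 _ <-] <-]] <-]]]|[q [es1 [es2 ->]]]].
  by exists q, es1, es2; rewrite punctured_embed.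
exists q => //; exists (blocks es1); first by exists es1.
exists (punctured (win q) ++ blocks es2); last by rewrite punctured_embed.
by exists (punctured (win q)) => //; exists (blocks es2) => //; exists es2.
Qed.

Lemma marker_punctured_words u : punctured_words u -> m \notin u.
Proof. by move=> /punctured_wordsP[q [es1 [es2 ->]]]; exact: marker_punctured. Qed.

Hypothesis removed_neq0 : forall q, removed (win q) != [::].
(* The automaton reading the removed letters does not know the window from
   which they have been taken. *)
Hypothesis test_removed :
  forall q q', removed (win q) = removed (win q') -> test q = test q'.

Definition marked theta bs : seq (R * 'I_k) := (theta, m) :: timed_blocks bs.

Lemma timed_word_marked theta bs : timed_word (marked theta bs) =
  [&& 0 < theta, all (fun t => 0 < t) (unzip1 bs) & all (@positive R E S) (unzip2 bs)].
Proof. by rewrite -timed_word_blocks. Qed.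

Lemma valid_wordsP z : valid_words (unzip2 z) <->
  exists theta bs, valid (unzip1 (unzip2 bs)) /\ z = marked theta bs.
Proof.
split=> [[_ -> [_ [es ves <-]]]|[theta [bs [vbs ->]]]].
  case: z => [//|[t a] z] [<- /esym/unzip2_eq_blocks[bs ebs ->]].
  by exists t, bs; rewrite ebs.
exists [:: m] => //; exists (blocks (unzip1 (unzip2 bs))); last first.
  by rewrite -unzip2_timed_blocks.
by exists (unzip1 (unzip2 bs)).
Qed.

Lemma marker_timed_blocks bs : all (fun ta => ta.2 != m) (timed_blocks bs).
Proof.
have := marker_punctured (full S (unzip1 (unzip2 bs))).
rewrite punctured_full -unzip2_timed_blocks => nm.
by apply/allP => ta ta_bs; apply: contraNneq nm => <-; exact: map_f.
Qed.

Lemma violation_testerE x : ta_lang R violation_tester x <->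
  timed_word x /\ (x = [::] \/ exists q t w, [/\ x = (t, m) :: w,
     unzip2 w = [seq slot p | p <- removed (win q)] & ~~ passes (test q) t w]).
Proof.
by apply: violation_automatonE => q; rewrite -size_eq0 size_map size_eq0.
Qed.

Lemma shuffle_timed_word z : equation_shuffle z -> timed_word z.
Proof.
move=> [x [y [/violation_testerE[tx _] [ty _] /all_shuffle_word sh]]].
by rewrite /timed_word sh; apply/andP.
Qed.

Lemma shuffle_nonvalid z : timed_word z -> ~ valid_words (unzip2 z) ->
  equation_shuffle z <-> (m \in unzip2 z \/ punctured_words (unzip2 z)).
Proof.
move=> tz nvalid; split=> [|mp].
  move=> [x [y [/violation_testerE[_ []]]]].
    by move=> -> [_ yf] /shuffle_word_nil <-; case: yf => [[]|]; [left|right].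
  move=> [q [t [w [-> _ _]]]] _ /(all_shuffle_word (fun ta => ta.2 != m)).
  move=> /= /[!eqxx] /= /allPn[ta taz /negPn/eqP <-]; left; exact: map_f.
exists [::], z; split; last exact: shuffle_word0l.
  by apply/violation_testerE; split=> //; left.
by split=> //; case: mp => [mz|]; [left|right].
Qed.

Lemma satisfied_embed theta vs q es1 es2 : satisfied theta vs ->
  unzip1 vs = unzip1 (embed es1 (win q) es2) ->
  passes (test q) theta (timed_removed vs (embed es1 (win q) es2)).
Proof.
move=> sat; rewrite unzip1_embed => /map_eq_cat3[vs1 [vw [vs2 [evs <- ew <-]]]].
by rewrite evs timed_removed_embed //; exact: sat evs ew.
Qed.

Lemma violated_shuffle theta bs : timed_word (marked theta bs) ->
  ~ satisfied theta (unzip2 bs) -> equation_shuffle (marked theta bs).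
Proof.
move=> tz /existsNP[q /existsNP[vs1 /existsNP[vw /existsNP[vs2]]]].
move=> /not_implyP[ebs /not_implyP[ew /negP viol]].
pose W := embed (unzip1 vs1) (win q) (unzip1 vs2).
have eW : unzip1 (unzip2 bs) = unzip1 W.
  by rewrite unzip1_embed ebs -ew /unzip1 !map_cat.
have [y sh yW] := shuffle_timed_blocks eW.
have {}sh := shuffle_word_consl (theta, m) sh.
have := tz; rewrite /timed_word (all_shuffle_word _ sh) => /andP[tx ty].
exists ((theta, m) :: timed_removed (unzip2 bs) W), y; split=> //.
  apply/violation_testerE; split=> //; right.
  exists q, theta, (timed_removed (unzip2 bs) W); split=> //.
    by rewrite unzip2_timed_removed // removed_embed.
  by rewrite ebs timed_removed_embed.
by split=> //; right; apply/punctured_wordsP; exists q, (unzip1 vs1), (unzip1 vs2).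
Qed.

Lemma shuffle_violated theta bs : valid (unzip1 (unzip2 bs)) ->
  equation_shuffle (marked theta bs) -> ~ satisfied theta (unzip2 bs).
Proof.
move=> vbs [x [y [/violation_testerE[_ xE] [_ yf] sh]]] sat.
have vz : valid_words (unzip2 (marked theta bs)).
  by apply/valid_wordsP; exists theta, bs.
case: xE => [ex|[q [t [w [ex wl /negP viol]]]]]; rewrite {x}ex in sh.
  rewrite (shuffle_word_nil sh) in yf; case: yf => [[_ /(_ vz)]//|].
  by move=> /marker_punctured_words; rewrite /= mem_head.
case: (shuffle_word_cons_inv sh) => -[z ez {}sh];
  have := all_shuffle_word (fun ta => ta.2 != m) sh; rewrite marker_timed_blocks /=;
  last by rewrite eqxx.
move: ez => [et ew]; rewrite {t}et in viol; rewrite -{z}ew in sh *.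
case: yf => [[/mapP[ta tay mE] _] /esym/andP[_ /allP/(_ _ tay)]|].
  by rewrite -mE eqxx.
move=> /punctured_wordsP[q' [es1 [es2 yW]]] _.
have [|eW wW] := shuffle_timed_blocks_inv sh _ yW.
  by rewrite wl all_map; apply/allP => p _ /=; rewrite is_header_slot.
move: wl; rewrite wW unzip2_timed_removed // removed_embed.
move=> /(inj_map (@slot_inj _ _))/test_removed qq'.
by apply: viol; rewrite wW -qq'; exact: satisfied_embed.
Qed.

Lemma shuffle_timed_regular :
  ~ (exists theta vs, solution theta vs) -> timed_regular equation_shuffle.
Proof.
move=> no_solution.
have [C LC] := recognizable_timed_regular R
  (recognizableU (recognizable_mem m) recognizable_punctured_words).
exists C; rewrite -LC; apply/seteqP; split=> z Lz.
  have tz := shuffle_timed_word Lz; split=> //.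
  have [/valid_wordsP[theta [bs [_ ->]]]|nvalid] := pselect (valid_words (unzip2 z)).
    by left; rewrite /= mem_head.
  exact/(shuffle_nonvalid tz nvalid).
move: Lz => [tz mp].
have [/valid_wordsP[theta [bs [vbs ez]]]|nvalid] := pselect (valid_words (unzip2 z)).
  rewrite ez in tz *; apply: violated_shuffle => // sat; apply: no_solution.
  move: tz; rewrite timed_word_marked => /and3P[theta0 _ pos].
  by exists theta, (unzip2 bs).
exact/(shuffle_nonvalid tz nvalid).
Qed.

Hypothesis valid_nil : ~ valid [::].

Lemma shuffle_not_timed_regular theta vs : theta < 1 -> solution theta vs ->
  (forall t, satisfied t vs -> t = theta) -> ~ timed_regular equation_shuffle.
Proof.
move=> theta1 [theta0 vvs pos sat] uniq_theta.
case: vs => [//|v vs] in vvs pos sat uniq_theta *.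
pose bs (tau : R) := (tau, v) :: [seq (1, v') | v' <- vs].
have unzip2_bs tau : unzip2 (bs tau) = v :: vs.
  by rewrite /unzip2 /= -map_comp map_id.
have timed_bs t tau : 0 < t -> 0 < tau -> timed_word (marked t (bs tau)).
  move=> t0 tau0; rewrite timed_word_marked t0 unzip2_bs pos /= tau0 andbT.
  by rewrite /unzip1 -map_comp all_map; apply/allP => v' _ /=; exact: ltr01.
apply: (@isolated_delay_not_timed_regular _ _ _ theta m (header S v.1)
  ([seq timed_slot v s | s <- enum S] ++ timed_blocks [seq (1, v') | v' <- vs])).
  by rewrite theta0.
move=> t tau t0 tau0; rewrite -[_ :: _]/(marked t (bs tau)); split=> [|tE].
  move=> /shuffle_violated; rewrite unzip2_bs => /(_ vvs) nsat tE.
  by rewrite tE in nsat.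
by apply: violated_shuffle; rewrite ?unzip2_bs ?timed_bs // => /uniq_theta.
Qed.

End Equations.

(** * Register machines as systems of equations between delays *)

Definition affine (x : nat) (c : nat * nat) : nat := (c.1 + c.2 * x)%N.

(* A register [r] ranges over the reals strictly between 0 and the affine
   function [rm_bound r] of a parameter. Executing [e] turns its value v into
   the v' with
     rm_pre e r * v + rm_post e r * (rm_bound r - v') = rm_const e r;
   initially [rm_init_weight r * v = rm_init_const r]. *)
Record register_machine := RegisterMachine {
  rm_register : finType;
  rm_instr : finType;
  rm_state : eqType;
  rm_source : rm_instr -> rm_state;
  rm_target : rm_instr -> rm_state;
  rm_final : pred rm_instr;
  rm_first : rm_instr;
  rm_bound : rm_register -> nat * nat;
  rm_init_weight : rm_register -> nat;
  rm_init_const : rm_register -> nat;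
  rm_pre : rm_instr -> rm_register -> nat;
  rm_post : rm_instr -> rm_register -> nat;
  rm_const : rm_instr -> rm_register -> nat * nat;
  rm_source_first : forall e, rm_source e = rm_source rm_first -> e = rm_first;
  rm_target_first : forall e, rm_target e != rm_source rm_first;
  rm_init_weight_gt0 : forall r, (0 < rm_init_weight r)%N;
  rm_pre_gt0 : forall e r, (0 < rm_pre e r)%N }.

Section Copies.
Variables (Reg : finType) (n : nat).

(* [Reference r b] holds the value of [r] if [b] and its complement to the
   bound of [r] otherwise; the others are the copies of the value, resp. of
   the complement for [PostCopy], that enter the equations with a weight. *)
Inductive copy :=
| Reference of Reg & bool
| InitCopy of Reg & 'I_n
| PreCopy of Reg & 'I_n
| PostCopy of Reg & 'I_n.

Definition copy_encode (s : copy) :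
    (Reg * bool + Reg * 'I_n + Reg * 'I_n + Reg * 'I_n)%type :=
  match s with
  | Reference r b => inl (inl (inl (r, b)))
  | InitCopy r i => inl (inl (inr (r, i)))
  | PreCopy r i => inl (inr (r, i))
  | PostCopy r i => inr (r, i)
  end.

Definition copy_decode c : copy :=
  match c with
  | inl (inl (inl (r, b))) => Reference r b
  | inl (inl (inr (r, i))) => InitCopy r i
  | inl (inr (r, i)) => PreCopy r i
  | inr (r, i) => PostCopy r i
  end.

Lemma copy_encodeK : cancel copy_encode copy_decode. Proof. by case. Qed.

HB.instance Definition _ := Finite.copy copy (can_type copy_encodeK).

Definition copy_register (s : copy) : Reg :=
  match s with Reference r _ | InitCopy r _ | PreCopy r _ | PostCopy r _ => r end.

Definition copy_sign (s : copy) : bool :=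
  match s with Reference _ b => b | InitCopy _ _ | PreCopy _ _ => true
  | PostCopy _ _ => false end.

Definition complement (s : copy) : copy :=
  Reference (copy_register s) (~~ copy_sign s).

End Copies.

Arguments Reference {Reg n} r b : rename.

Section Equation.
Variables (Instr Reg : finType) (n : nat).

(* [MarkerBound] isolates the delay of the marker, by adding to it the delay of
   the slot [None] of the first block. *)
Inductive equation :=
| Complementarity of Instr & copy Reg n
| Initialization of Reg
| Execution of Instr & Instr & Reg
| MarkerBound.

Definition equation_encode (q : equation) :
    (Instr * copy Reg n + Reg + Instr * Instr * Reg + unit)%type :=
  match q with
  | Complementarity e s => inl (inl (inl (e, s)))
  | Initialization r => inl (inl (inr r))
  | Execution e e' r => inl (inr (e, e', r))
  | MarkerBound => inr tt
  end.

Definition equation_decode c : equation :=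
  match c with
  | inl (inl (inl (e, s))) => Complementarity e s
  | inl (inl (inr r)) => Initialization r
  | inl (inr (e, e', r)) => Execution e e' r
  | inr tt => MarkerBound
  end.

Lemma equation_encodeK : cancel equation_encode equation_decode.
Proof. by case=> // [[]]. Qed.

HB.instance Definition _ := Finite.copy equation (can_type equation_encodeK).

End Equation.

Arguments Initialization {Instr Reg n} r : rename.
Arguments Execution {Instr Reg n} e e' r : rename.
Arguments MarkerBound {Instr Reg n}.

Section MachineEquations.
Variable P : register_machine.

Definition max_weight : nat :=
  \max_(p : rm_instr P * rm_register P)
    maxn (rm_init_weight p.2) (maxn (rm_pre p.1 p.2) (rm_post p.1 p.2)).

Local Notation reg := (rm_register P).
Local Notation instr := (rm_instr P).
Local Notation cell := (option (copy reg max_weight.+1)).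
Local Notation equation := (equation instr reg max_weight.+1).
Implicit Types (e : instr) (r : reg) (q : equation).

Lemma init_weight_le_max r : (rm_init_weight r <= max_weight)%N.
Proof. by apply: leq_trans (leq_bigmax (rm_first P, r)); rewrite leq_maxl. Qed.

Lemma pre_le_max e r : (rm_pre e r <= max_weight)%N.
Proof. by apply: leq_trans (leq_bigmax (e, r)); rewrite !leq_max leqnn orbT. Qed.

Lemma post_le_max e r : (rm_post e r <= max_weight)%N.
Proof. by apply: leq_trans (leq_bigmax (e, r)); rewrite !leq_max leqnn !orbT. Qed.

Definition copies (c : 'I_max_weight.+1 -> copy reg max_weight.+1) (n : nat) :
    {set cell} :=
  [set Some (c i) | i : 'I_max_weight.+1 & (i < n)%N].

Definition equation_window q : window instr cell :=
  match q with
  | Complementarity e s => [:: (e, [set Some s; Some (complement s)])]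
  | Initialization r => [:: (rm_first P, copies (InitCopy r) (rm_init_weight r))]
  | Execution e e' r => [:: (e, copies (PreCopy r) (rm_pre e r));
                            (e', copies (PostCopy r) (rm_post e r))]
  | MarkerBound => [:: (rm_first P, [set None])]
  end.

Definition equation_const q : nat * nat :=
  match q with
  | Complementarity _ s => rm_bound (copy_register s)
  | Initialization r => (rm_init_const r, 0%N)
  | Execution e _ r => rm_const e r
  | MarkerBound => (1%N, 0%N)
  end.

Definition equation_marker q : bool := if q is MarkerBound then true else false.

Definition equation_test (x : nat) q : sum_test :=
  SumTest (equation_marker q) (affine x (equation_const q)).

Definition key_letter q : instr * cell :=
  match q with
  | Complementarity e s => (e, Some (complement s))
  | Initialization r => (rm_first P, Some (InitCopy r ord0))
  | Execution e _ r => (e, Some (PreCopy r ord0))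
  | MarkerBound => (rm_first P, None)
  end.

Lemma mem_removed_execution e e' r y :
  (y \in removed (equation_window (Execution e e' r))) =
  (y.1 == e) && (y.2 \in copies (PreCopy r) (rm_pre e r)) ||
  (y.1 == e') && (y.2 \in copies (PostCopy r) (rm_post e r)).
Proof. by rewrite [equation_window _]/= -cat1s removed_cat mem_cat !mem_removed1. Qed.

Lemma key_letter_removed q : key_letter q \in removed (equation_window q).
Proof.
case: q => [e s|r|e e' r|]; rewrite ?mem_removed_execution ?mem_removed1 eqxx /=.
- by rewrite !inE eqxx orbT.
- by apply/imsetP; exists ord0 => //; rewrite inE rm_init_weight_gt0.
- by apply/orP; left; apply/imsetP; exists ord0 => //; rewrite inE rm_pre_gt0.
by rewrite inE.
Qed.

Lemma removed_window_neq0 q : removed (equation_window q) != [::].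
Proof. by have := key_letter_removed q; case: removed. Qed.

Lemma equation_test_removed x q q' :
  removed (equation_window q) = removed (equation_window q') ->
  equation_test x q = equation_test x q'.
Proof.
move=> eqq'; have := key_letter_removed q'; rewrite -eqq'.
have := key_letter_removed q; rewrite {1}eqq' /equation_test {eqq'}.
case: q => [e s|r|e e' r|]; case: q' => [f s'|r'|f f' r'|];
  rewrite ?mem_removed_execution ?mem_removed1 ?inE ?andbF //=.
(* Two equations of different kinds never contain the key letters of each other. *)
all: try by [move=> /andP[_ /imsetP[]] | move=> _ /andP[_ /imsetP[]]
            | move=> /orP[] /andP[_ /imsetP[]] | move=> _ /orP[] /andP[_ /imsetP[]]].
- by move=> /andP[_ /orP[/eqP[<-]|/eqP[->]]].
- by move=> /andP[_ /imsetP[i _ [->]]].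
by move=> /orP[/andP[/eqP-> /imsetP[i _ [->]]]|/andP[_ /imsetP[]]].
Qed.

End MachineEquations.

Section MachineRuns.
Variables (R : realType) (P : register_machine) (x : nat).

Local Notation reg := (rm_register P).
Local Notation instr := (rm_instr P).
Local Notation cell := (option (copy reg (max_weight P).+1)).
Local Notation test := (@equation_test P x).
Local Notation satisfied := (@satisfied R _ _ _ (@equation_window P) test).
Implicit Types (e : instr) (r : reg) (sigma : reg -> R) (b : instr * (reg -> R)).
Implicit Types (v : valuation R instr cell) (vs : seq (valuation R instr cell)).

Definition limit r : R := (affine x (rm_bound r))%:R.
Definition in_range sigma : bool := [forall r, 0 < sigma r < limit r].
Definition initial sigma : bool :=
  [forall r, (rm_init_weight r)%:R * sigma r == (rm_init_const r)%:R].
Definition linked e sigma sigma' : bool :=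
  [forall r, (rm_pre e r)%:R * sigma r + (rm_post e r)%:R * (limit r - sigma' r) ==
             (affine x (rm_const e r))%:R].

Definition follows e e' : bool := ~~ rm_final e && (rm_target e == rm_source e').
Definition step b b' : bool := follows b.1 b'.1 && linked b.1 b.2 b'.2.
Definition computation b l : bool :=
  [&& path step b l, rm_final (last b l).1 & all (fun b' => in_range b'.2) (b :: l)].
Definition halts p sigma : Prop :=
  exists e l, rm_source e = p /\ computation (e, sigma) l.
Definition program_words : set (seq instr) :=
  chain (pred1 (rm_first P)) (@rm_final P) follows.

Lemma halts_final e sigma : rm_final e -> in_range sigma -> halts (rm_source e) sigma.
Proof. by move=> fe rs; exists e, [::]; rewrite /computation /= fe rs. Qed.

Lemma halts_step e sigma sigma' : ~~ rm_final e -> in_range sigma ->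
  linked e sigma sigma' -> halts (rm_target e) sigma' -> halts (rm_source e) sigma.
Proof.
move=> nfe rs lk [e' [l [se' /and3P[pl fl rl]]]]; exists e, ((e', sigma') :: l).
split=> //; apply/and3P; split=> //=; last by rewrite rs.
by rewrite {1}/step /follows nfe se' eqxx lk.
Qed.

Definition copy_val sigma n (s : copy reg n) : R :=
  if copy_sign s then sigma (copy_register s)
  else limit (copy_register s) - sigma (copy_register s).

Lemma duration_removed_cons v vs e (X : {set cell}) W :
  duration (timed_removed (v :: vs) ((e, X) :: W)) =
  \sum_(s in X) v.2 s + duration (timed_removed vs W).
Proof.
by rewrite /duration big_cat /= big_map big_filter big_enum_cond.
Qed.

Lemma duration_removed1 v e (X : {set cell}) :
  duration (timed_removed [:: v] [:: (e, X)]) = \sum_(s in X) v.2 s.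
Proof. by rewrite duration_removed_cons /duration big_nil addr0. Qed.

Lemma sum_copies (c : 'I_(max_weight P).+1 -> copy reg (max_weight P).+1) n v (t : R) :
  injective c -> (n <= max_weight P)%N -> (forall i, v.2 (Some (c i)) = t) ->
  \sum_(s in copies c n) v.2 s = n%:R * t.
Proof.
move=> c_inj nmax vt; rewrite big_imset => [|i j _ _ [/c_inj]//].
rewrite (eq_bigr (fun=> t)) => [|i _]; last exact: vt.
rewrite big_mkcond /=; under eq_bigr do rewrite inE.
by rewrite -big_mkcond (big_ord_narrow (leqW nmax)) sumr_const card_ord mulr_natl.
Qed.

Definition represents v sigma : Prop := forall s, v.2 (Some s) = copy_val sigma s.

Lemma passes_complementarity e s theta v :
  passes (test (Complementarity e s)) theta
    (timed_removed [:: v] (equation_window (Complementarity e s))) =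
  (v.2 (Some s) + v.2 (Some (complement s)) == limit (copy_register s)).
Proof.
rewrite /passes /= add0r duration_removed1 big_setU1 ?big_set1 // inE.
by apply/eqP => -[/(congr1 (@copy_sign _ _)) /=]; case: copy_sign.
Qed.

Lemma passes_initialization r theta v sigma : represents v sigma ->
  passes (test (Initialization r)) theta
    (timed_removed [:: v] (equation_window (Initialization r))) =
  ((rm_init_weight r)%:R * sigma r == (rm_init_const r)%:R).
Proof.
move=> vs; rewrite /passes /= add0r duration_removed1 (sum_copies (t := sigma r)) //.
- by rewrite /affine mul0n addn0.
- by move=> i j [].
exact: init_weight_le_max.
Qed.

Lemma passes_execution e e' r theta v v' sigma sigma' :
  represents v sigma -> represents v' sigma' ->
  passes (test (Execution e e' r)) theta
    (timed_removed [:: v; v'] (equation_window (Execution e e' r))) =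
  ((rm_pre e r)%:R * sigma r + (rm_post e r)%:R * (limit r - sigma' r) ==
   (affine x (rm_const e r))%:R).
Proof.
move=> vs vs'; rewrite /passes /= add0r duration_removed_cons duration_removed1.
rewrite (sum_copies (t := sigma r)) ?pre_le_max //; last by move=> i j [].
by rewrite (sum_copies (t := limit r - sigma' r)) ?post_le_max // => i j [].
Qed.

Lemma passes_marker_bound theta v :
  passes (test MarkerBound) theta
    (timed_removed [:: v] (equation_window (@MarkerBound instr reg _))) =
  (theta + v.2 None == 1).
Proof. by rewrite /passes /= duration_removed1 big_set1 /affine mul0n. Qed.

Section SolutionToComputation.
Variables (theta : R) (vs : seq (valuation R instr cell)).
Hypothesis vs_solution : solution program_words (@equation_window P) test theta vs.

Definition reference_val v : reg -> R := fun r => v.2 (Some (Reference r true)).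
Definition read v : instr * (reg -> R) := (v.1, reference_val v).

Lemma solution_represents vs1 v vs2 :
  vs = vs1 ++ v :: vs2 -> represents v (reference_val v).
Proof.
have [_ _ _ sat] := vs_solution => evs s.
have compl s' : v.2 (Some s') + v.2 (Some (complement s')) = limit (copy_register s').
  have := sat (Complementarity v.1 s') vs1 [:: v] vs2 evs erefl.
  by rewrite passes_complementarity => /eqP.
have := compl s; have := compl (Reference (copy_register s) true).
rewrite /copy_val /reference_val /complement /=.
by case: (copy_sign s) => /=; lra.
Qed.

Lemma solution_in_range vs1 v vs2 :
  vs = vs1 ++ v :: vs2 -> in_range (reference_val v).
Proof.
move=> evs; apply/forallP => r; have rep := solution_represents evs.
have [_ _ + _] := vs_solution; rewrite evs all_cat /= => /and3P[_ /forallP pos _].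
have := pos (Some (Reference r true)); have := pos (Some (Reference r false)).
by rewrite rep /copy_val /= subr_gt0 => -> ->.
Qed.

Lemma solution_linked vs1 v v' vs2 : vs = vs1 ++ v :: v' :: vs2 ->
  linked v.1 (reference_val v) (reference_val v').
Proof.
have [_ _ _ sat] := vs_solution => evs; apply/forallP => r.
have rep := solution_represents evs; have evs' := evs; rewrite -cat_rcons in evs'.
have := sat (Execution v.1 v'.1 r) vs1 [:: v; v'] vs2 evs erefl.
by rewrite (passes_execution _ _ _ _ rep (solution_represents evs')).
Qed.

Lemma solution_initial v vs' : vs = v :: vs' -> v.1 = rm_first P ->
  initial (reference_val v).
Proof.
have [_ _ _ sat] := vs_solution => evs ev; apply/forallP => r.
have := sat (Initialization r) [::] [:: v] vs' evs; rewrite /= ev => /(_ erefl).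
by rewrite (passes_initialization _ _ (solution_represents (vs1 := [::]) evs)).
Qed.

Lemma solution_computation vs1 v vs2 : vs = vs1 ++ v :: vs2 ->
  path follows v.1 (unzip1 vs2) -> rm_final (last v.1 (unzip1 vs2)) ->
  computation (read v) (map read vs2).
Proof.
elim: vs2 vs1 v => [|v' vs2 IH] vs1 v evs; rewrite /computation /=.
  by rewrite (solution_in_range evs) => _ ->.
move=> /andP[vv' pv'] fv'; rewrite (solution_in_range evs).
have := IH (rcons vs1 v) v'; rewrite cat_rcons => /(_ evs pv' fv') /and3P[-> -> /= ->].
by rewrite {1}/step vv' (solution_linked evs).
Qed.

Lemma solution_halts :
  exists2 sigma, initial sigma & halts (rm_source (rm_first P)) sigma.
Proof.
have [_ + _ _] := vs_solution; case evs : vs => [//|v vs'] /and3P[/eqP v1 pv fv].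
exists (reference_val v); first exact: solution_initial evs v1.
exists v.1, (map read vs'); split; first by rewrite v1.
exact: (solution_computation (vs1 := [::]) evs pv fv).
Qed.

End SolutionToComputation.

Definition block_valuation b : valuation R instr cell :=
  (b.1, fun s => if s is Some c then copy_val b.2 c else 1 / 2).

Lemma block_valuation_represents b : represents (block_valuation b) b.2.
Proof. by []. Qed.

Lemma block_valuation_positive b : in_range b.2 -> positive (block_valuation b).
Proof.
move=> /forallP rb; apply/forallP => -[s|] /=; last by lra.
by have := rb (copy_register s); rewrite /copy_val; case: copy_sign; lra.
Qed.

Lemma unzip1_block_valuation (l : seq (instr * (reg -> R))) :
  unzip1 (map block_valuation l) = unzip1 l.
Proof. by rewrite /unzip1 -map_comp. Qed.

Lemma path_first b l1 b' l2 : path step b (l1 ++ b' :: l2) -> b'.1 != rm_first P.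
Proof.
rewrite cat_path /= => /and3P[_ /andP[/andP[_ /eqP bb'] _] _].
by apply: contraTneq (rm_target_first (last b l1).1) => b'1; rewrite bb' b'1 eqxx.
Qed.

Lemma computation_satisfied sigma l : initial sigma ->
  path step (rm_first P, sigma) l ->
  satisfied (1 / 2) (map block_valuation ((rm_first P, sigma) :: l)).
Proof.
move=> /forallP init_sigma pl q vs1 vw vs2 /map_eq_cat3[l1 [lw [l2 [el _ <- _]]]].
rewrite unzip1_block_valuation.
case: q => [e s|r|e e' r|].
- case: lw el => [//|b [|//]] _ _; rewrite passes_complementarity /= /copy_val /=.
  by case: copy_sign; apply/eqP => /=; lra.
- case: lw el => [//|b [|//]] el [b1].
  rewrite (passes_initialization _ _ (block_valuation_represents b)).
  case: l1 el => [[<- _]|b0 l1 [_ el]]; first exact: init_sigma.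
  by move: pl; rewrite el => /path_first; rewrite b1 eqxx.
- case: lw el => [//|b [//|b' [|//]]] el [be _].
  rewrite (passes_execution _ _ _ _ (block_valuation_represents b)
    (block_valuation_represents b')).
  have : sorted step ((rm_first P, sigma) :: l) by [].
  rewrite el => /cat_sorted2[_ /= /andP[/andP[_ /forallP/(_ r)]]].
  by rewrite be.
case: lw el => [//|b [|//]] _ _; rewrite passes_marker_bound /=.
by apply/eqP; lra.
Qed.

Lemma halts_solution sigma : initial sigma -> halts (rm_source (rm_first P)) sigma ->
  exists theta vs, [/\ theta < 1,
    solution program_words (@equation_window P) test theta vs
    & forall t, satisfied t vs -> t = theta].
Proof.
move=> init_sigma [e [l [/rm_source_first-> /and3P[pl fl rl]]]].
have pl' : path follows (rm_first P) (unzip1 l).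
  by apply: (homo_path (f := fst)) pl => b b' /andP[].
exists (1 / 2), (map block_valuation ((rm_first P, sigma) :: l)); split; first lra.
- split; first lra; last exact: computation_satisfied.
    rewrite unzip1_block_valuation; apply/and3P; split=> //=.
    by have := last_map fst l (rm_first P, sigma); rewrite /= => ->.
  rewrite all_map; apply: sub_all rl => b; exact: block_valuation_positive.
move=> t /(_ MarkerBound [::] [:: block_valuation (rm_first P, sigma)]) sat.
have := sat (map block_valuation l) erefl erefl.
by rewrite passes_marker_bound /= => /eqP; lra.
Qed.

Lemma machine_shuffle_regularE :
  timed_regular (@equation_shuffle R _ _ program_words _ (@equation_window P) test) <->
  ~ exists2 sigma, initial sigma & halts (rm_source (rm_first P)) sigma.
Proof.
split=> [reg_shuffle [sigma init_sigma /(halts_solution init_sigma)]|no_halt].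
  move=> [theta [vs [theta1 sol uniq_theta]]]; move: reg_shuffle.
  apply: (shuffle_not_timed_regular _ _ _ theta1 sol uniq_theta) => //.
    exact: removed_window_neq0.
  exact: (@equation_test_removed P x).
apply: (shuffle_timed_regular (@removed_window_neq0 P)).
by move=> [theta [vs /solution_halts]].
Qed.

End MachineRuns.

(** * Simulation of a Turing machine *)

(* A template is a binary word with holes; filling its holes with x ones gives
   the code of the x-th pair of automata. *)
Definition template := seq (option bool).

Definition expand (x : nat) (T : template) : seq bool :=
  flatten [seq if o is Some b then [:: b] else nseq x true | o <- T].

Definition template_digit (o : option bool) : nat :=
  match o with Some false => 1 | Some true => 2 | None => 3 end.

Definition template_number (T : template) : nat :=
  foldr (fun o n => 4 * n + template_digit o)%N 0%N T.

Lemma template_number_inj : injective template_number.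
Proof.
elim=> [|o T IH] [|o' T'] //=.
- by case: o' => [[]|] /=; lia.
- by case: o => [[]|] /=; lia.
move=> e; suff [-> /IH ->] : o = o' /\ template_number T = template_number T' by [].
by move: e; case: o o' => [[]|] [[]|] /=; split=> //; lia.
Qed.

Lemma template_number_catr T T' : (template_number T' <= template_number (T ++ T'))%N.
Proof. by elim: T => //= o T; lia. Qed.

Lemma natr_close (R : realType) (m n : nat) :
  m%:R < n%:R + 1 :> R -> n%:R < m%:R + 1 :> R -> m = n.
Proof.
rewrite !natr1 !ltr_nat !ltnS => mn nm.
by apply/eqP; rewrite eqn_leq mn nm.
Qed.

Section Instructions.
Variables Q A : finType.

Inductive instruction :=
| Initialize
| AppendBit of bool
| AppendHole
| FillOne
| FinishHole
| Launch of A
| Simulate of Q & A & A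
| Accept of Q & A.

Definition instruction_encode (e : instruction) :
    (bool * bool + bool + A + Q * A * A + Q * A)%type :=
  match e with
  | Initialize => inl (inl (inl (inl (false, false))))
  | AppendHole => inl (inl (inl (inl (false, true))))
  | FillOne => inl (inl (inl (inl (true, false))))
  | FinishHole => inl (inl (inl (inl (true, true))))
  | AppendBit b => inl (inl (inl (inr b)))
  | Launch a => inl (inl (inr a))
  | Simulate q a a' => inl (inr (q, a, a'))
  | Accept q a => inr (q, a)
  end.

Definition instruction_decode c : instruction :=
  match c with
  | inl (inl (inl (inl (false, false)))) => Initialize
  | inl (inl (inl (inl (false, true)))) => AppendHole
  | inl (inl (inl (inl (true, false)))) => FillOne
  | inl (inl (inl (inl (true, true)))) => FinishHole
  | inl (inl (inl (inr b))) => AppendBit b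
  | inl (inl (inr a)) => Launch a
  | inl (inr (q, a, a')) => Simulate q a a'
  | inr (q, a) => Accept q a
  end.

Lemma instruction_encodeK : cancel instruction_encode instruction_decode.
Proof. by case. Qed.

HB.instance Definition _ := Finite.copy instruction (can_type instruction_encodeK).

(* The template is guessed digit by digit, from its end, and expanded onto the
   tape in phase [Building]; the ones of a hole are pushed in phase [Filling];
   in phase [Running q a] the simulated machine is in state [q] and reads [a]. *)
Inductive phase := Initializing | Building | Filling | Running of Q & A.

Definition phase_encode (p : phase) : (option bool + Q * A)%type :=
  match p with
  | Initializing => inl None
  | Building => inl (Some true)
  | Filling => inl (Some false)
  | Running q a => inr (q, a)
  end.

Definition phase_decode c : phase :=
  match c with
  | inl None => Initializing
  | inl (Some true) => Building
  | inl (Some false) => Filling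
  | inr (q, a) => Running q a
  end.

Lemma phase_encodeK : cancel phase_encode phase_decode.
Proof. by case. Qed.

HB.instance Definition _ := Equality.copy phase (can_type phase_encodeK).

End Instructions.

Arguments Initialize {Q A}.
Arguments AppendBit {Q A} b : rename.
Arguments AppendHole {Q A}.
Arguments FillOne {Q A}.
Arguments FinishHole {Q A}.
Arguments Launch {Q A} a : rename.
Arguments Initializing {Q A}.
Arguments Building {Q A}.
Arguments Filling {Q A}.

Inductive register := LeftTape | RightTape | Number | Counter.

Definition register_encode (r : register) : bool * bool :=
  match r with
  | LeftTape => (false, false)
  | RightTape => (false, true)
  | Number => (true, false)
  | Counter => (true, true)
  end.

Definition register_decode c : register :=
  match c with
  | (false, false) => LeftTape
  | (false, true) => RightTape
  | (true, false) => Number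
  | (true, true) => Counter
  end.

Lemma register_encodeK : cancel register_encode register_decode.
Proof. by case. Qed.

HB.instance Definition _ := Finite.copy register (can_type register_encodeK).

Definition is_tape (r : register) : bool :=
  match r with LeftTape | RightTape => true | Number | Counter => false end.

Section Simulator.
Variable M : turing_machine.
Local Notation Sym := (tm_sym M).
Local Notation blank := (tm_blank M).
Local Notation instr := (instruction (tm_state M) (tm_sym M)).
Local Notation phase := (phase (tm_state M) (tm_sym M)).
Implicit Types (q : tm_state M) (a : Sym) (s l r : seq Sym) (e : instr) (T : template).

(* As in [tm_step], a halted machine stays in its configuration. *)
Definition effect q a : tm_state M * Sym * move :=
  if tm_verdict q is Some _ then (q, a, MoveN) else tm_delta q a.

Lemma tm_step_effect q l a r : tm_step (@TMConfig M q l a r) =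
  let: (q', b, d) := effect q a in
  match d with
  | MoveL => TMConfig q' (behead l) (head blank l) (b :: r)
  | MoveN => TMConfig q' l b r
  | MoveR => TMConfig q' (b :: l) (head blank r) (behead r)
  end.
Proof. by rewrite /effect /=; case: (tm_verdict q). Qed.

Definition source e : phase :=
  match e with
  | Initialize => Initializing
  | AppendBit _ | AppendHole | Launch _ => Building
  | FillOne | FinishHole => Filling
  | Simulate q a _ | Accept q a => Running q a
  end.

(* The last argument of [Simulate q a a'] is the symbol under the head after a
   move. *)
Definition target_phase e : phase :=
  match e with
  | Initialize | AppendBit _ | FinishHole => Building
  | AppendHole | FillOne => Filling
  | Launch a => Running (tm_start M) a
  | Simulate q a a' =>
      let: (q', b, d) := effect q a in Running q' (if d is MoveN then b else a')
  | Accept q a => Running q a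
  end.

Definition accepting e : bool :=
  if e is Accept q _ then tm_verdict q == Some true else false.

Inductive operation :=
| Keep | Push of Sym | Pop of Sym | Append of nat | Increment | Subtract.

Definition operation_of e (i : register) : operation :=
  match e, i with
  | AppendBit b, RightTape => Push (tm_input M b)
  | AppendBit b, Number => Append (template_digit (Some b))
  | AppendHole, Number => Append (template_digit None)
  | FillOne, RightTape => Push (tm_input M true)
  | FillOne, Counter => Increment
  | FinishHole, Counter => Subtract
  | Launch a, RightTape => Pop a
  | Launch _, Number => Subtract
  | Simulate q a a', _ =>
      let: (_, b, d) := effect q a in
      match d, i with
      | MoveL, LeftTape | MoveR, RightTape => Pop a'
      | MoveL, RightTape | MoveR, LeftTape => Push b
      | _, _ => Keep
      end
  | _, _ => Keep
  end.

Definition base : nat := (#|{: Sym}| + 4)%N.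
Definition digit a : nat := (enum_rank a).+1.

(* Tape registers are fractions between 0 and 1; the value of a number register
   holding n is n + 1, hence its complement is x + 1 - n. *)
Definition register_bound (i : register) : nat * nat :=
  if is_tape i then (1%N, 0%N) else (2%N, 1%N).
Definition initial_weight (i : register) : nat := if is_tape i then base.-1 else 1%N.
Definition initial_const (i : register) : nat := if is_tape i then digit blank else 1%N.
Definition weight_before e (i : register) : nat :=
  match operation_of e i with Pop _ => base | Append _ => 4%N | _ => 1%N end.
Definition weight_after e (i : register) : nat :=
  if operation_of e i is Push _ then base else 1%N.
Definition operation_const e (i : register) : nat * nat :=
  match operation_of e i with
  | Keep => register_bound i
  | Push a => ((base - digit a)%N, 0%N)
  | Pop a => ((digit a).+1, 0%N)
  | Append d => ((5 - d)%N, 1%N)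
  | Increment => (1%N, 1%N)
  | Subtract => (2%N, 2%N)
  end.

Lemma source_initialize_inj e : source e = source Initialize -> e = Initialize.
Proof. by case: e. Qed.

Lemma target_phase_neq_initial e : target_phase e != source Initialize.
Proof. by case: e => //= q a a'; case: (effect q a) => [[]]. Qed.

Lemma initial_weight_gt0 i : (0 < initial_weight i)%N.
Proof. by rewrite /initial_weight /base; case: is_tape; lia. Qed.

Lemma weight_before_gt0 e i : (0 < weight_before e i)%N.
Proof. by rewrite /weight_before /base; case: (operation_of e i) => *; lia. Qed.

Definition simulator : register_machine :=
  RegisterMachine accepting register_bound initial_const weight_after operation_const
    source_initialize_inj target_phase_neq_initial initial_weight_gt0 weight_before_gt0.

Lemma digit_inj : injective digit.
Proof. by move=> a b [] /val_inj/enum_rank_inj. Qed.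

Lemma digit_lt a : (0 < digit a < base.-2)%N.
Proof.
rewrite /digit /base; have : (enum_rank a < #|{: Sym}|)%N by exact: ltn_ord.
by move: (nat_of_ord _) => i; move: #|_| => n; lia.
Qed.

Variables (R : realType) (x : nat).
Implicit Types (sigma : register -> R) (v : R) (n j : nat).

Local Notation sim_in_range := (@in_range R simulator x).
Local Notation sim_linked := (@linked R simulator x).
Local Notation sim_initial := (@initial R simulator).
Local Notation sim_halts := (@halts R simulator x).

Lemma limit_simulator i : @limit R simulator x i = if is_tape i then 1 else x%:R + 2.
Proof.
rewrite /limit /affine /= /register_bound; case: is_tape; first by rewrite mul0n addn0.
by rewrite mul1n natrD addrC.
Qed.

Lemma in_range_simulator sigma i : sim_in_range sigma ->
  0 < sigma i < (if is_tape i then 1 else x%:R + 2).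
Proof. by move=> /forallP/(_ i); rewrite limit_simulator. Qed.

Definition performs (o : operation) v v' : Prop :=
  match o with
  | Keep => v' = v
  | Push a => base%:R * v' = (digit a)%:R + v
  | Pop a => base%:R * v = (digit a)%:R + v'
  | Append d => v' - 1 = 4 * (v - 1) + d%:R
  | Increment => v' = v + 1
  | Subtract => v' = v - x%:R
  end.

Lemma operation_of_register e i :
  match operation_of e i with
  | Keep => true
  | Push _ | Pop _ => is_tape i
  | Append d => ~~ is_tape i && (d <= 5)%N
  | Increment | Subtract => ~~ is_tape i
  end.
Proof.
case: i; case: e => [|[]||||a|q a a'|q a] //=.
all: by case: (effect q a) => [[q' b] []].
Qed.

Lemma linked_simulator e sigma sigma' : sim_linked e sigma sigma' <->
  forall i, performs (operation_of e i) (sigma i) (sigma' i).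
Proof.
suff performsE i : (weight_before e i)%:R * sigma i +
    (weight_after e i)%:R * (@limit R simulator x i - sigma' i) =
    (affine x (operation_const e i))%:R <->
    performs (operation_of e i) (sigma i) (sigma' i).
  split=> [/forallP lk i|lk]; first by apply/performsE/eqP; exact: lk.
  by apply/forallP => i; apply/eqP/performsE.
rewrite limit_simulator /affine /weight_before /weight_after /operation_const.
have := operation_of_register e i; have dlt := digit_lt.
case: (operation_of e i) => [|a|a|d||]; rewrite /register_bound; case: is_tape => //=;
  rewrite ?mul0n ?mul1n ?addn0 => h; rewrite ?natrB //; try by move: (dlt a); lia.
all: rewrite ?natrD ?natrM ?(natrB _ h) -?(natr1 (digit _)); split=> e'; lra.
Qed.

Definition tape_val s : R :=
  foldr (fun a v => ((digit a)%:R + v) / base%:R) ((digit blank)%:R / base.-1%:R) s.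

Lemma base_neq0 : base%:R != 0 :> R.
Proof. by rewrite pnatr_eq0 /base addn4. Qed.

Lemma base_predE : base.-1%:R = base%:R - 1 :> R.
Proof. by rewrite -subn1 natrB // /base addn4. Qed.

Lemma base_pred_neq0 : base.-1%:R != 0 :> R.
Proof. by rewrite pnatr_eq0 /base addn4. Qed.

Lemma digit_bounds a : 1 <= ((digit a)%:R : R) <= base%:R - 2.
Proof.
have /andP[d0 db] := digit_lt a; rewrite ler1n d0 /=.
have -> : base%:R - 2 = base.-2%:R :> R by rewrite -subn2 natrB // /base addn4.
by rewrite ler_nat ltnW.
Qed.

Lemma tape_valE s : base%:R * tape_val s =
  (digit (head blank s))%:R + tape_val (behead s).
Proof.
have := base_pred_neq0; rewrite base_predE => base1.
case: s => [|a s] /=; rewrite ?base_predE; field => //; exact: base_neq0.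
Qed.

Lemma tape_val_bounds s : 0 < tape_val s < 1.
Proof.
have b4 : 4 <= base%:R :> R by rewrite (ler_nat R 4) /base addn4.
elim: s => [|a s IH] /=; rewrite ?base_predE.
  have /andP[? ?] := digit_bounds blank.
  by rewrite divr_gt0 ?ltr_pdivrMr; lra.
move: IH => /andP[? ?]; have /andP[? ?] := digit_bounds a.
by rewrite divr_gt0 ?ltr_pdivrMr; lra.
Qed.

Lemma performs_push a s v : performs (Push a) (tape_val s) v <-> v = tape_val (a :: s).
Proof.
split=> [/= <-|->]; first by rewrite mulrC mulKf // base_neq0.
exact: (tape_valE (a :: s)).
Qed.

Lemma performs_pop a s v : 0 < v < 1 ->
  performs (Pop a) (tape_val s) v <-> a = head blank s /\ v = tape_val (behead s).
Proof.
move=> v01; rewrite /performs tape_valE; split=> [e|[-> ->] //].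
have vs := tape_val_bounds (behead s).
suff ea : a = head blank s by split=> //; move: e; rewrite ea; lra.
by apply: digit_inj; apply: (@natr_close R); lra.
Qed.

Lemma performs_append d n v :
  performs (Append d) (n%:R + 1) v <-> v = (4 * n + d)%:R + 1.
Proof. by rewrite /= natrD natrM; split=> e; lra. Qed.

Lemma performs_increment n v : performs Increment (n%:R + 1) v <-> v = n.+1%:R + 1.
Proof. by rewrite /= natr1. Qed.

Lemma performs_subtract n v : 0 < v -> n%:R + 1 < x%:R + 2 :> R ->
  performs Subtract (n%:R + 1) v <-> n = x /\ v = 0%:R + 1.
Proof.
move=> v0 nx; rewrite /=; split=> [e|[-> ->]]; last by lra.
suff nE : n = x by split=> //; rewrite e nE; lra.
by apply: (@natr_close R); lra.
Qed.

Definition registers l r n j : register -> R := fun i =>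
  match i with
  | LeftTape => tape_val l
  | RightTape => tape_val r
  | Number => n%:R + 1
  | Counter => j%:R + 1
  end.

Lemma registersP sigma l r n j : sigma LeftTape = tape_val l ->
  sigma RightTape = tape_val r -> sigma Number = n%:R + 1 -> sigma Counter = j%:R + 1 ->
  sigma = registers l r n j.
Proof. by move=> sl sr sn sj; apply/funext => -[]. Qed.

Lemma initial_simulator sigma : sim_initial sigma <-> sigma = registers [::] [::] 0 0.
Proof.
split=> [/forallP init|->].
  have weight i : (initial_weight i)%:R * sigma i = (initial_const i)%:R.
    exact/eqP/init.
  have tape i : is_tape i -> sigma i = tape_val [::].
    move=> ti; have := weight i; rewrite /initial_weight /initial_const ti /= => <-.
    by rewrite mulrC mulKf // base_pred_neq0.
  apply: registersP; [exact: tape | exact: tape | |].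
    by have := weight Number; rewrite /initial_weight /= mul1r add0r.
  by have := weight Counter; rewrite /initial_weight /= mul1r add0r.
apply/forallP => -[]; rewrite /= /initial_weight /initial_const /= ?mul1r ?add0r //.
  by rewrite mulrC divfK ?base_pred_neq0.
by rewrite mulrC divfK ?base_pred_neq0.
Qed.

Lemma registers_in_range l r n j : (n <= x)%N -> (j <= x)%N ->
  sim_in_range (registers l r n j).
Proof.
rewrite -!(ler_nat R) => nx jx; apply/forallP => i; rewrite limit_simulator.
have := ler0n R n; have := ler0n R j.
by case: i => /=; rewrite ?tape_val_bounds //; lra.
Qed.

Local Notation input w := [seq tm_input M b | b <- w].

Definition consistent (p : phase) sigma : Prop :=
  match p with
  | Initializing => sim_initial sigma
  | Building => exists T,
      sigma = registers [::] (input (expand x T)) (template_number T) 0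
  | Filling => exists T j,
      sigma = registers [::] (input (nseq j true ++ expand x T))
                (template_number (None :: T)) j
  | Running q a => exists T n l r, [/\ template_number T = x,
      iter n (@tm_step M) (tm_init M (expand x T)) = TMConfig q l a r
      & sigma = registers l r 0 0]
  end.

Section ConsistentStep.
Variables sigma sigma' : register -> R.
Hypothesis sigma_range : sim_in_range sigma.
Hypothesis sigma'_range : sim_in_range sigma'.

Local Notation linked_by e :=
  (forall i, performs (operation_of e i) (sigma i) (sigma' i)).

Let tape_range' i : is_tape i -> 0 < sigma' i < 1.
Proof. by move=> ti; have := in_range_simulator i sigma'_range; rewrite ti. Qed.

Let pop_at i a s : is_tape i -> performs (Pop a) (tape_val s) (sigma' i) ->
  a = head blank s /\ sigma' i = tape_val (behead s).
Proof. by move=> /tape_range' v01 /(performs_pop a s v01). Qed.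

Let number_range i : ~~ is_tape i -> sigma i < x%:R + 2.
Proof.
by move=> /negbTE ti; have := in_range_simulator i sigma_range; rewrite ti => /andP[].
Qed.

Let positive' i : 0 < sigma' i.
Proof. by have /andP[] := in_range_simulator i sigma'_range. Qed.

Lemma consistent_initialize : linked_by Initialize ->
  consistent Initializing sigma -> consistent Building sigma'.
Proof.
move=> perf /initial_simulator sE; exists [::]; rewrite -sE.
by apply/funext => i; have := perf i; case: i.
Qed.

Lemma consistent_append_bit b : linked_by (AppendBit b) ->
  consistent Building sigma -> consistent Building sigma'.
Proof.
move=> perf [T sE]; rewrite sE in perf; exists (Some b :: T).
by apply: registersP; [exact: (perf LeftTape) | exact/performs_push/(perf RightTape)
  | exact/performs_append/(perf Number) | exact: (perf Counter)].
Qed.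

Lemma consistent_append_hole : linked_by AppendHole ->
  consistent Building sigma -> consistent Filling sigma'.
Proof.
move=> perf [T sE]; rewrite sE in perf; exists T, 0%N.
by apply: registersP; [exact: (perf LeftTape) | exact: (perf RightTape)
  | exact/performs_append/(perf Number) | exact: (perf Counter)].
Qed.

Lemma consistent_fill_one : linked_by FillOne ->
  consistent Filling sigma -> consistent Filling sigma'.
Proof.
move=> perf [T [j sE]]; rewrite sE in perf; exists T, j.+1.
by apply: registersP; [exact: (perf LeftTape) | exact/performs_push/(perf RightTape)
  | exact: (perf Number) | exact/performs_increment/(perf Counter)].
Qed.

Lemma consistent_finish_hole : linked_by FinishHole ->
  consistent Filling sigma -> consistent Building sigma'.
Proof.
move=> perf [T [j sE]]; have := number_range (i := Counter) isT.
rewrite sE in perf * => /= jx; exists (None :: T).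
have [jE Counter1] := (performs_subtract (positive' Counter) jx).1 (perf Counter).
rewrite {}jE in perf.
by apply: registersP; [exact: (perf LeftTape) | exact: (perf RightTape)
  | exact: (perf Number) | exact: Counter1].
Qed.

Lemma consistent_launch a : linked_by (Launch a) ->
  consistent Building sigma -> consistent (Running (tm_start M) a) sigma'.
Proof.
move=> perf [T sE]; have := number_range (i := Number) isT.
rewrite sE in perf * => /= nx.
have [Tx Number1] := (performs_subtract (positive' Number) nx).1 (perf Number).
have [ea right'] := pop_at (i := RightTape) isT (perf RightTape).
exists T, 0%N, [::], (behead (input (expand x T))); split=> //.
  by rewrite /= /tm_init -ea.
by apply: registersP; [exact: (perf LeftTape) | exact: right'
  | exact: Number1 | exact: (perf Counter)].
Qed.

Lemma consistent_simulate q a a' : linked_by (Simulate q a a') ->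
  consistent (Running q a) sigma -> consistent (target_phase (Simulate q a a')) sigma'.
Proof.
move=> perf [T [n [l [r [Tx run sE]]]]]; rewrite {}sE in perf.
have {run}: iter n.+1 (@tm_step M) (tm_init M (expand x T)) =
    tm_step (TMConfig q l a r) by rewrite -run.
move: perf; rewrite tm_step_effect /=; case: (effect q a) => -[q' b] [] perf run.
- have [ea left'] := pop_at (i := LeftTape) isT (perf LeftTape).
  exists T, n.+1, (behead l), (b :: r); split; rewrite ?ea //.
  by apply: registersP; [exact: left' | exact/performs_push/(perf RightTape)
    | exact: (perf Number) | exact: (perf Counter)].
- exists T, n.+1, l, r; split=> //.
  by apply: registersP; [exact: (perf LeftTape) | exact: (perf RightTape)
    | exact: (perf Number) | exact: (perf Counter)].
have [ea right'] := pop_at (i := RightTape) isT (perf RightTape).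
exists T, n.+1, (b :: l), (behead r); split; rewrite ?ea //.
by apply: registersP; [exact/performs_push/(perf LeftTape) | exact: right'
  | exact: (perf Number) | exact: (perf Counter)].
Qed.

Lemma consistent_accept q a : linked_by (Accept q a) ->
  consistent (Running q a) sigma -> consistent (Running q a) sigma'.
Proof.
move=> perf; suff -> : sigma' = sigma by [].
by apply/funext => i; exact: perf.
Qed.

Lemma consistent_step e : sim_linked e sigma sigma' ->
  consistent (source e) sigma -> consistent (target_phase e) sigma'.
Proof.
move=> /linked_simulator; case: e => [|b||||a|q a a'|q a].
- exact: consistent_initialize.
- exact: consistent_append_bit.
- exact: consistent_append_hole.
- exact: consistent_fill_one.
- exact: consistent_finish_hole.
- exact: consistent_launch.
- exact: consistent_simulate.
exact: consistent_accept.
Qed.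

End ConsistentStep.

Lemma halts_sound p sigma : sim_halts p sigma -> consistent p sigma ->
  exists2 T, template_number T = x & tm_answers M (expand x T) true.
Proof.
move=> [e [l [<- /and3P[]]]].
elim: l e sigma => [|[e' sigma'] l IH] e sigma /=.
  move=> _; case: e => // q a /eqP vq _ [T [n [k [r [Tx run _]]]]].
  by exists T => //; exists n; rewrite run.
move=> /andP[/andP[/andP[_ /eqP ee'] lk] pl] fl /andP[sigma_range range_l].
have /andP[sigma'_range _] := range_l.
move=> cons; apply: (IH e' sigma') => //.
by rewrite -ee'; exact: (consistent_step sigma_range sigma'_range lk cons).
Qed.

Lemma simulator_step e sigma sigma' : ~~ accepting e -> sim_in_range sigma ->
  (forall i, performs (operation_of e i) (sigma i) (sigma' i)) ->
  sim_halts (target_phase e) sigma' -> sim_halts (source e) sigma.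
Proof. by move=> nacc sigma_range /linked_simulator; exact: halts_step. Qed.

Lemma halts_running n q l a r :
  tm_verdict (c_state (iter n (@tm_step M) (TMConfig q l a r))) = Some true ->
  sim_halts (Running q a) (registers l r 0 0).
Proof.
elim: n q l a r => [|n IH] q l a r.
  move=> vq; apply: (@halts_final R simulator x (Accept q a)).
    by apply/eqP.
  exact: registers_in_range.
rewrite iterSr tm_step_effect; case ef : (effect q a) => [[q' b] []] /IH next_halts.
- apply: (@simulator_step (Simulate q a (head blank l)) _
    (registers (behead l) (b :: r) 0 0)); rewrite /= ?ef //.
    exact: registers_in_range.
  by case=> //; [exact: tape_valE | exact/performs_push].
- apply: (@simulator_step (Simulate q a b) _ (registers l r 0 0)); rewrite /= ?ef //.
  exact: registers_in_range.
apply: (@simulator_step (Simulate q a (head blank r)) _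
  (registers (b :: l) (behead r) 0 0)); rewrite /= ?ef //.
  exact: registers_in_range.
by case=> //; [exact/performs_push | exact: tape_valE].
Qed.

Lemma halts_launch T : template_number T = x -> tm_answers M (expand x T) true ->
  sim_halts Building (registers [::] (input (expand x T)) (template_number T) 0).
Proof.
move=> Tx [n /halts_running run].
apply: (@simulator_step (Launch _) _ _ _ _ _ run) => //.
  by apply: registers_in_range; rewrite ?Tx.
case=> //=; first exact: tape_valE.
by rewrite Tx; lra.
Qed.

Lemma halts_filling T j : (j <= x)%N -> (template_number (None :: T) <= x)%N ->
  sim_halts Building
    (registers [::] (input (expand x (None :: T))) (template_number (None :: T)) 0) ->
  sim_halts Filling
    (registers [::] (input (nseq j true ++ expand x T))
       (template_number (None :: T)) j).
Proof.
move=> jx Tx building; rewrite -(subKn jx); elim: (x - j)%N => [|i IH].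
  rewrite subn0; apply: (@simulator_step FinishHole _ _ _ _ _ building) => //.
    exact: registers_in_range.
  by case=> //=; lra.
have [ix|xi] := ltnP i x; last by move: IH; rewrite (eqP xi) (eqP (leqW xi)).
move: IH; rewrite -(subnSK ix) => IH.
apply: (@simulator_step FillOne _ _ _ _ _ IH) => //.
  by apply: registers_in_range; rewrite ?leq_subr.
by case=> //; [exact/performs_push | exact/performs_increment].
Qed.

Lemma halts_append o T : (template_number (o :: T) <= x)%N ->
  sim_halts Building
    (registers [::] (input (expand x (o :: T))) (template_number (o :: T)) 0) ->
  sim_halts Building (registers [::] (input (expand x T)) (template_number T) 0).
Proof.
move=> oTx; have Tx : (template_number T <= x)%N.
  exact: leq_trans (template_number_catr [:: o] T) oTx.
case: o oTx => [b|] oTx building.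
  apply: (@simulator_step (AppendBit b) _ _ _ _ _ building) => //.
    exact: registers_in_range.
  by case=> //; [exact/performs_push | exact/performs_append].
have filling := halts_filling (leq0n x) oTx building.
apply: (@simulator_step AppendHole _ _ _ _ _ filling) => //.
  exact: registers_in_range.
by case=> //; exact/performs_append.
Qed.

Lemma halts_building T1 T2 : template_number (T1 ++ T2) = x ->
  tm_answers M (expand x (T1 ++ T2)) true ->
  sim_halts Building (registers [::] (input (expand x T2)) (template_number T2) 0).
Proof.
elim/last_ind: T1 T2 => [|T1 o IH] T2; first exact: halts_launch.
rewrite cat_rcons => Tx answer; apply: (@halts_append o); last exact: IH.
by rewrite -Tx; exact: template_number_catr.
Qed.

Lemma simulator_haltsE T : template_number T = x ->
  (exists2 sigma, sim_initial sigma & sim_halts Initializing sigma) <->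
  tm_answers M (expand x T) true.
Proof.
move=> Tx; split=> [[sigma init /halts_sound/(_ init)[T' T'x]]|answer].
  by rewrite (template_number_inj (etrans Tx (esym T'x))).
exists (registers [::] [::] 0 0); first exact/initial_simulator.
have := @halts_building T [::]; rewrite cats0 => /(_ Tx answer) building.
apply: (@simulator_step Initialize _ _ _ _ _ building) => //.
exact: registers_in_range.
Qed.

End Simulator.

(** * The fixed point *)

Definition has_template (f : nat -> seq bool) : Prop :=
  exists T, forall x, f x = expand x T.

Lemma has_template_const w : has_template (fun=> w).
Proof.
exists [seq Some b | b <- w] => x; elim: w => //= b w IH.
by rewrite {1}IH.
Qed.

Lemma has_template_cat f g : has_template f -> has_template g ->
  has_template (fun x => f x ++ g x).
Proof.
move=> [T fT] [T' gT']; exists (T ++ T') => x.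
by rewrite /expand map_cat flatten_cat -/(expand x T) -fT -/(expand x T') -gT'.
Qed.

Lemma has_template_affine c : has_template (fun x => code_nat (affine x c)).
Proof.
have ones_template : has_template (fun x => nseq (c.2 * x) true).
  elim: c.2 => [|n IH]; first exact: has_template_const.
  have [T eT] : has_template (fun x => nseq x true ++ nseq (n * x) true).
    by apply: has_template_cat IH; exists [:: None] => x; rewrite /expand /= cats0.
  by exists T => x; rewrite mulSn nseqD.
have [T eT] := has_template_cat (has_template_cat (has_template_const (nseq c.1 true))
  ones_template) (has_template_const [:: false]).
by exists T => x; rewrite -eT /code_nat /affine cats1 nseqD.
Qed.

Definition code_items (T : Type) (e : T -> seq bool) (s : seq T) : seq bool :=
  flatten [seq true :: e y | y <- s].

Lemma has_template_items (I T : Type) (e : T -> seq bool) (g : nat -> I -> T)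
    (s : seq I) :
  (forall i, has_template (fun x => e (g x i))) ->
  has_template (fun x => code_items e [seq g x i | i <- s]).
Proof.
move=> te; elim: s => [|i s IH] /=; first exact: has_template_const.
exact: (has_template_cat (has_template_cat (has_template_const [:: true]) (te i)) IH).
Qed.

Lemma has_template_items_cat (T : Type) (e : T -> seq bool) (s s' : nat -> seq T) :
  has_template (fun x => code_items e (s x)) ->
  has_template (fun x => code_items e (s' x)) ->
  has_template (fun x => code_items e (s x ++ s' x)).
Proof.
move=> ts ts'; have [t et] := has_template_cat ts ts'.
by exists t => x; rewrite -et /code_items map_cat flatten_cat.
Qed.

Lemma has_template_ta k n m (I F : seq 'I_n) (D : nat -> seq (transition k n m)) :
  has_template (fun x => code_items (@code_trans k n m) (D x)) ->
  has_template (fun x => code_ta (TimedAutomaton I F (D x))).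
Proof.
move=> tD; rewrite /code_ta /=.
do 4![apply: has_template_cat; first exact: has_template_const].
have [T eT] := has_template_cat tD (has_template_const [:: false]).
by exists T => x; rewrite -eT /code_seq cats1.
Qed.

Lemma has_template_trans k n m p (a : 'I_k) (g : nat -> guard m) X (q : 'I_n) :
  has_template (fun x => code_guard (g x)) ->
  has_template (fun x => code_trans (Transition p a (g x) X q)).
Proof.
move=> tg; rewrite /code_trans /=.
do 2![apply: has_template_cat; first exact: has_template_const].
by apply: has_template_cat tg _; exact: has_template_const.
Qed.

Lemma has_template_violation_automaton k (m : 'I_k) (W : finType)
    (letters : W -> seq 'I_k) (marked : W -> bool) (const : W -> nat * nat) :
  has_template (fun x => code_ta (violation_automaton m letters
    (fun w => SumTest (marked w) (affine x (const w))))).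
Proof.
apply/has_template_ta/has_template_items_cat; apply: has_template_items => i /=.
  exact: has_template_const.
apply: has_template_trans; case: (_ == _); last exact: has_template_const.
do 4![apply: has_template_cat; first exact: has_template_const].
exact: has_template_affine.
Qed.

Lemma tm_answers_unique (M : turing_machine) w b b' :
  tm_answers M w b -> tm_answers M w b' -> b = b'.
Proof.
have halted n c d : tm_verdict (c_state c) = Some d ->
    tm_verdict (c_state (iter n (@tm_step M) c)) = Some d.
  move=> vc; elim: n => //= n; case: (iter n _ c) => q l a r /= vq.
  by rewrite vq.
move=> [n vn] [n' vn'].
have := halted n' _ _ vn; have := halted n _ _ vn'; rewrite -!iterD addnC => -> [].
by move=> ->.
Qed.

Section SelfApplication.
Variables (R : realType) (M : turing_machine).
Local Notation P := (simulator M).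
Local Notation window_of := (@equation_window P).
Local Notation simulator_filler := (filler (@program_words P) window_of).

Lemma recognizable_simulator_filler : recognizable simulator_filler.
Proof. exact/recognizable_filler/recognizable_chain. Qed.

Variable B : timed_automaton 
  (alphabet_size (rm_instr P) (option (copy register (max_weight P).+1))).

Definition simulator_pair (x : nat) : ta_pair :=
  TAPair (violation_tester window_of (@equation_test P x)) B.

Lemma simulator_pair_template : has_template (fun x => code_pair (simulator_pair x)).
Proof.
apply: has_template_cat; first exact: has_template_const.
apply: has_template_cat; last exact: (has_template_const (code_ta B)).
exact: has_template_violation_automaton.
Qed.

Hypothesis B_filler : timings R simulator_filler = ta_lang R B.

Lemma simulator_pair_regular T : let x := template_number T in
  timed_regular (shuffle (ta_lang R (pair_fst (simulator_pair x)))
                         (ta_lang R (pair_snd (simulator_pair x)))) <->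
  ~ tm_answers M (expand x T) true.
Proof.
move=> x; rewrite /= -B_filler -(simulator_haltsE M R (erefl x)).
exact: (@machine_shuffle_regularE R P x).
Qed.

End SelfApplication.

Theorem theorem5 (R : realType) :
  ~ algorithmically_decidable code_pair
      (fun p => timed_regular
                  (shuffle (ta_lang R (pair_fst p)) (ta_lang R (pair_snd p)))).
Proof.
move=> [M decides].
have [B B_filler] := recognizable_timed_regular R (recognizable_simulator_filler M).
have [T codeT] := simulator_pair_template B.
have [b [answer]] := decides (simulator_pair B (template_number T)).
have := simulator_pair_regular B_filler T.
rewrite /= -codeT => -[regular_rejected rejected_regular].
case: b answer => answer [yes no]; first exact: (regular_rejected (yes isT)).
suff : false by []; apply: no; apply: rejected_regular => accepted.
by have := tm_answers_unique answer accepted.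
Qed.
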